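(* Let $X$ be a compact metric space and let $\mathcal{G}$ be a null decomposition of $X$ such that each non-singleton element of $\mathcal{G}$ is a recursively starlike-equivalent subset of $X$. Then $\mathcal{G}$ is strongly shrinkable (and, thus, the quotient map $\pi : X \to X/\mathcal{G}$ is a strong near homeomorphism).
   Context: A decomposition of a topological space $X$ means an upper semi-continuous decomposition: a partition $\mathcal{G}$ of $X$ into compact subsets such that the quotient map $\pi : X \to X/\mathcal{G}$ (with $X/\mathcal{G}$ given the quotient topology) is a closed map. If $X$ is compact metrizable, then so is $X/\mathcal{G}$. A collection $\mathcal{C}$ of subsets of a metric space $(X,\rho)$ is null if for every $\epsilon > 0$ the set $\{C \in \mathcal{C} : \mathrm{diam}_\rho(C) \geq \epsilon\}$ is finite. A null decomposition is a decomposition that is a null collection. A subset $A$ of $\mathbb{R}^n$ is starlike if $A$ is compact and there is a point $x \in A$ such that for each $y \in A$ the straight-line segment joining $x$ to $y$ lies in $A$. A subset $A$ of a compact metrizable space $X$ is starlike-equivalent if there are an open neighborhood $U$ of $A$ in $X$ and an embedding $e : U \to \mathbb{R}^n$ (for some $n$) such that $e(U)$ is an open subset of $\mathbb{R}^n$ and $e(A)$ is a starlike subset of $\mathbb{R}^n$. For a compact subset $B$ of $X$, $X/B$ denotes the quotient space $X/\mathcal{G}_B$, where $\mathcal{G}_B = \{B\} \cup \{\{x\} : x \in X - B\}$ (that is, $B$ is collapsed to a point); $X/B$ is again compact metrizable. For a compact set $A$ with $B \subset A \subset X$, $A/B$ denotes the image of $A$ under the quotient map $X \to X/B$. A subset $A$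 of a compact metrizable space $X$ is recursively starlike-equivalent of filtration length $\leq m$ ($m \geq 1$) if there is a finite sequence $A_1 \subset \cdots \subset A_{m+1}$ of compact subsets of $X$ such that $A_1$ is a starlike-equivalent subset of $X$, $A_i/A_{i-1}$ is a starlike-equivalent subset of $X/A_{i-1}$ for $2 \leq i \leq m+1$, and $A_{m+1} = A$; filtration length $\leq 0$ means that $A$ itself is starlike-equivalent. $A$ is recursively starlike-equivalent if it is recursively starlike-equivalent of filtration length $\leq m$ for some $m \ge 0$ (no uniform bound on $m$ over the elements of a decomposition is assumed). A map $\pi : X \to Y$ injects over $C \subset Y$ if $\pi|_{\pi^{-1}(C)} : \pi^{-1}(C) \to C$ is injective. Let $\pi : X \to Y$ be an onto map (continuous surjection) between compact metric spaces with metrics $\rho$ and $\sigma$ respectively, and let $\bar{\sigma}$ be the supremum metric on the set $C(X,Y)$ of continuous maps $X \to Y$ determined by $\sigma$. The map $\pi$ satisfies the strong shrinking criterion if for every $\delta > 0$ and every closed subset $C$ of $Y$ such that $\pi$ injects over $C$, there is a homeomorphism $h : X \to X$ such that $\mathrm{diam}_\rho(h(\pi^{-1}(y))) < \delta$ for every $y \in Y$, $\bar{\sigma}(\pi, \pi \circ h^{-1}) < \delta$, and $h|_{\pi^{-1}(C)} = \mathrm{id}_{\pi^{-1}(C)}$. The map $\pi$ is a strong near homeomorphism if for every $\epsilon > 0$ and every closed subset $C$ of $Y$ such that $\pi$ injects over $C$, there is a homeomorphism $f : X \to Y$ such that $\bar{\sigma}(\pi, f) < \epsilon$ and $f|_{\pi^{-1}(C)}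 = \pi|_{\pi^{-1}(C)}$. A decomposition $\mathcal{G}$ of a compact metric space $X$ is strongly shrinkable if the quotient map $\pi : X \to X/\mathcal{G}$ satisfies the strong shrinking criterion (with $X/\mathcal{G}$ equipped with any metric inducing its topology). *)

(* Defs.v *)
From HB Require Import structures.
From mathcomp Require Import all_boot all_order all_algebra.
From mathcomp Require Import all_classical all_reals all_analysis.

Set Implicit Arguments.
Unset Strict Implicit.
Unset Printing Implicit Defensive.

Import Order.TTheory GRing.Theory Num.Theory.
Import numFieldTopology.Exports.

Local Open Scope classical_set_scope.
Local Open Scope ring_scope.
Local Open Scope quotient_scope.

Definition homeomorphism (X Y : topologicalType) (h : X -> Y) (k : Y -> X) :=
  [/\ cancel h k, cancel k h, continuous h & continuous k].

(* The values of e outside A are irrelevant; the last clause is continuity of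
   the inverse e(A) -> A, for the subspace topologies. *)
Definition embedding_on (X Y : topologicalType) (A : set X) (e : X -> Y) :=
  [/\ set_inj A e, {within A, continuous e} &
    forall W : set X, open W ->
      exists2 V : set Y, open V & e @` (A `&` W) = e @` A `&` V].

Section Metrics.
Context {R : realType}.

Definition is_metric (T : Type) (d : T -> T -> R) :=
  [/\ forall x y, d x y = 0 <-> x = y,
      forall x y, d x y = d y x &
      forall x y z, d x z <= d x y + d y z].

Definition compatible_metric (T : topologicalType) (d : T -> T -> R) :=
  is_metric d /\
  forall (x : T) (A : set T),
    nbhs x A <-> exists2 r : R, 0 < r & [set y | d x y < r] `<=` A.

Definition diam (T : Type) (d : T -> T -> R) (A : set T) : \bar R :=
  ereal_sup [set (d x y)%:E | x in A & y in A].

Definition null_collection (T : Type) (d : T -> T -> R) (C : set (set T)) :=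
  forall eps : R, 0 < eps -> finite_set [set A | C A /\ (eps%:E <= diam d A)%E].

Definition sup_dist (T Y : Type) (d : Y -> Y -> R) (f g : T -> Y) : \bar R :=
  ereal_sup [set (d (f x) (g x))%:E | x in [set: T]].

End Metrics.

Section DecompositionSpace.
Variables (X : topologicalType) (G : set (set X)).

(* For a partition G this is "x and y lie in the same element of G" (see
   quotient_map_eqP below); in this form it is an equivalence relation for
   every G, so that the quotient type does not depend on a proof. *)
Definition same_block : rel X :=
  fun x y => `[< forall A, G A -> (A x <-> A y) >].

Lemma same_block_refl : reflexive same_block.
Proof. by move=> x; apply/asboolP. Qed.

Lemma same_block_sym : symmetric same_block.
Proof.
by move=> x y; apply/asboolP/asboolP => H A GA; have [] := H _ GA; split.
Qed.

Lemma same_block_trans : transitive same_block.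
Proof.
move=> y x z /asboolP H1 /asboolP H2; apply/asboolP => A GA.
by rewrite (propext (H1 _ GA)); exact: H2.
Qed.

Canonical same_block_equiv :=
  EquivRel same_block same_block_refl same_block_sym same_block_trans.

Definition decomposition_space : topologicalType :=
  quotient_topology {eq_quot same_block}.

Definition quotient_map : X -> decomposition_space :=
  \pi_(quotient_topology {eq_quot same_block}).

Lemma quotient_map_eqP : partition G id [set: X] -> forall x y,
  quotient_map x = quotient_map y <-> exists A, [/\ G A, A x & A y].
Proof.
move=> [covG trivG _] x y; split.
  move=> /eqquotP /asboolP H.
  have /= : cover G id x by rewrite covG.
  by case=> A GA Ax; exists A; split => //; exact/(H A GA).
case=> A [GA Ax Ay]; apply/eqquotP; apply/asboolP => B GB; split => [Bx|By].
  by rewrite -(trivG A B GA GB) //; exists x.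
by rewrite -(trivG A B GA GB) //; exists y.
Qed.

(* Upper semi-continuous decompositions. *)
Definition decomposition :=
  [/\ partition G id [set: X],
      forall A, G A -> compact A &
      forall F : set X, closed F -> closed (quotient_map @` F)].

End DecompositionSpace.

Arguments decomposition_space {X} G.
Arguments quotient_map {X} G.

Definition collapse (X : topologicalType) (B : set X) : set (set X) :=
  [set B] `|` [set [set x] | x in ~` B].

Section Starlike.
Variable R : realType.

Definition starlike n (S : set 'rV[R]_n) :=
  compact S /\
  exists2 x, S x &
    forall y, S y -> forall t : R, 0 <= t <= 1 -> S ((1 - t) *: x + t *: y).

Definition starlike_equivalent (X : topologicalType) (A : set X) :=
  exists (U : set X) (n : nat) (e : X -> 'rV[R]_n),
    [/\ open U, A `<=` U, embedding_on U e, open (e @` U) & starlike (e @` A)].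

(* F 0, ..., F m are the sets usually numbered A_1, ..., A_{m+1}. *)
Definition starlike_filtration (X : topologicalType) (m : nat) (A : set X) :=
  exists F : nat -> set X,
    [/\ forall i, (i <= m)%N -> compact (F i),
        starlike_equivalent (F 0%N),
        forall i, (i < m)%N ->
          F i `<=` F i.+1 /\
          starlike_equivalent (quotient_map (collapse (F i)) @` F i.+1) &
        F m = A].

Definition recursively_starlike_equivalent (X : topologicalType) (A : set X) :=
  exists m : nat, starlike_filtration m A.

Lemma starlike_equivalent_compact (X : topologicalType) (A : set X) :
  starlike_equivalent A -> compact A.
Proof.
move=> [U [n [e [oU AU [einj _ eopen] oeU [cS _]]]]] F PF FA.
have FeA : (e @ F) (e @` A).
  by rewrite /fmap /=; apply: filterS FA => x Ax; exists x.
have [_ [[a Aa <-] clu]] := cS (e @ F) _ FeA.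
exists a; split => // B N FB aN.
have [V oV eV] := eopen _ (open_interior N).
have eaV : nbhs (e a) (e @` U `&` V).
  apply: open_nbhs_nbhs; split; first exact: openI.
  by rewrite -eV; exists a => //; split; [exact: AU|].
have FBA : (e @ F) (e @` (B `&` A)).
  by rewrite /fmap /=; apply: filterS (filterI FB FA) => x BAx; exists x.
have [_ [[b [Bb Ab] <-]]] := clu _ _ FBA eaV.
rewrite -eV => -[c [Uc Nc] ecb].
have cb : c = b by apply: einj; rewrite ?inE //; exact: AU.
by exists b; split => //; rewrite -cb; exact: interior_subset.
Qed.

Lemma starlike_filtration0 (X : topologicalType) (A : set X) :
  starlike_filtration 0 A <-> starlike_equivalent A.
Proof.
split=> [[F [_ SF _ <-]]//|sA]; exists (fun=> A); split => // i _.
exact: starlike_equivalent_compact.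
Qed.

End Starlike.

Section Shrinking.
Context {R : realType} {X Y : topologicalType}.
Variables (rho : X -> X -> R) (sigma : Y -> Y -> R) (p : X -> Y).

Definition injects_over (C : set Y) := set_inj (p @^-1` C) p.

Definition strong_shrinking_criterion :=
  forall (delta : R) (C : set Y), 0 < delta -> closed C -> injects_over C ->
    exists h k : X -> X,
      [/\ homeomorphism h k,
          forall y, (diam rho (h @` (p @^-1` [set y])) < delta%:E)%E,
          (sup_dist sigma p (p \o k) < delta%:E)%E &
          forall x, (p @^-1` C) x -> h x = x].

Definition strong_near_homeomorphism :=
  forall (eps : R) (C : set Y), 0 < eps -> closed C -> injects_over C ->
    exists (f : X -> Y) (g : Y -> X),
      [/\ homeomorphism f g,
          (sup_dist sigma p f < eps%:E)%E &
          forall x, (p @^-1` C) x -> f x = p x].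

End Shrinking.

(* X / G carries no preferred metric: we ask for the criterion for every metric
   inducing the quotient topology. *)
Definition strongly_shrinkable (R : realType) (X : metricType R)
    (G : set (set X)) :=
  forall sigma : decomposition_space G -> decomposition_space G -> R,
    compatible_metric sigma ->
    strong_shrinking_criterion (@mdist R X) sigma (quotient_map G).

(* Main.v *)
Require Import Defs.
From HB Require Import structures.
From mathcomp Require Import all_boot all_order all_algebra.
From mathcomp Require Import all_classical all_reals all_analysis.
From mathcomp Require Import lra.

(** Call [A] null-shrinkable if, for each family [H] of sets that become small as
they approach [A], some homeomorphism supported near [A] makes [A] arbitrarily
small, while each member of [H] either is fixed pointwise or has a small image.
Near each element of a null decomposition the size of the other elements tends to
[0], so this is exactly what is needed to shrink one element without
spoiling the others. The theorem is then the conjunction of four facts.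

A starlike-equivalent set is null-shrinkable ([starlike_null_shrinkable]). In the
chart let [S] be the star, [x0] its centre, and scale each point [x] towards
[x0] by a factor depending only on the distance from [x] to [S]. This distance does not
decrease along rays from [x0], so any monotone factor gives a bijection. The factor
is tiny on [S] and equal to [1] off a small neighbourhood, and it can be
chosen to vary so slowly near [S] that it is almost constant on each member of
[H] ([slow_profile]); small members therefore keep a small image.

If [B] is null-shrinkable and [A / B] is starlike-equivalent in [X / B], then [A] is
null-shrinkable ([null_shrinkable_extend]). Iterated shrinking of [B] has a limit
[p : X -> X] whose only nondegenerate fibre is [B] ([collapse_to_self]), so that
[X / B] is a copy of [X] and [p] can be approximated by homeomorphisms that agree
with it off any given neighbourhood of [B]. Shrink [p @` A], which is
starlike-equivalent, and precompose with such an approximation. By induction on the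
length of the filtration, a recursively starlike-equivalent set is null-shrinkable.

In a null decomposition only finitely many elements are large. Shrinking them in disjoint
saturated neighbourhoods gives the strong shrinking criterion
([null_strong_shrinking]).

Finally, the strong shrinking criterion implies the approximability of the quotient map by
homeomorphisms, by Bing's argument ([strong_shrinking_near_homeomorphism]). *)

Set Implicit Arguments.
Unset Strict Implicit.
Unset Printing Implicit Defensive.

Import Order.TTheory GRing.Theory Num.Theory.
Import numFieldNormedType.Exports.

Local Open Scope classical_set_scope.
Local Open Scope ring_scope.

(** * Metrics inducing a given topology *)

Section CompatibleMetric.
Context {R : realType} {T : topologicalType} {d : T -> T -> R}.
Hypothesis hd : compatible_metric d.

Lemma cmetric_eq0 x y : d x y = 0 -> x = y.
Proof. by case: hd => -[h _ _] _ /h. Qed.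

Lemma cmetric_refl x : d x x = 0.
Proof. by case: hd => -[h _ _] _; exact/h. Qed.

Lemma cmetric_sym x y : d x y = d y x.
Proof. by case: hd => -[_ h _] _. Qed.

Lemma cmetric_tri y x z : d x z <= d x y + d y z.
Proof. by case: hd => -[_ _ h] _. Qed.

Lemma cmetric_ge0 x y : 0 <= d x y.
Proof.
have := cmetric_tri y x x.
by rewrite cmetric_refl (cmetric_sym y x) -mulr2n pmulrn_lge0.
Qed.

Lemma cmetric_gt0 x y : x <> y -> 0 < d x y.
Proof.
by move=> xy; rewrite lt0r cmetric_ge0 andbT; apply/eqP => /cmetric_eq0.
Qed.

Lemma cmetric_eqP x y : (forall e, 0 < e -> d x y < e) -> x = y.
Proof.
move=> h; apply: contrapT => /cmetric_gt0 xy.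
by have := h _ xy; rewrite ltxx.
Qed.

Lemma cmetric_nbhsP x (A : set T) :
  nbhs x A <-> exists2 r : R, 0 < r & forall y, d x y < r -> A y.
Proof. by case: hd. Qed.

Lemma cmetric_nbhs_ball x r : 0 < r -> nbhs x [set y | d x y < r].
Proof. by move=> r0; apply/cmetric_nbhsP; exists r. Qed.

Lemma cmetric_openP (A : set T) :
  open A <-> forall x, A x -> exists2 r : R, 0 < r & forall y, d x y < r -> A y.
Proof.
split=> [oA x Ax|h]; first by apply/cmetric_nbhsP; exact: open_nbhs_nbhs.
by rewrite openE => x Ax; apply/cmetric_nbhsP; exact: h.
Qed.

Lemma cmetric_open_ball x r : open [set y | d x y < r].
Proof.
apply/cmetric_openP => y /= xy; exists (r - d x y); first by rewrite subr_gt0.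
by move=> z yz; have := cmetric_tri y x z; lra.
Qed.

Lemma cmetric_hausdorff : hausdorff_space T.
Proof.
move=> p q clpq; apply: cmetric_eqP => e e0.
have e2 : 0 < e / 2 by rewrite divr_gt0.
have [z [/= pz qz]] := clpq _ _ (cmetric_nbhs_ball p e2) (cmetric_nbhs_ball q e2).
by have := cmetric_tri z p q; rewrite (cmetric_sym z q); lra.
Qed.

Lemma cmetric_compact_closed (A : set T) : compact A -> closed A.
Proof. exact: compact_closed cmetric_hausdorff. Qed.

(** Every uniform choice of a radius below comes from this form of the Lebesgue
number lemma. The cover is replaced by a relation [Q], so that the same lemma gives
uniform continuity, with [Q] a bound on the images, and uniform neighbourhoods
of [K], with [Q] membership in an open set. *)
Lemma lebesgue_number (K : set T) (Q : T -> T -> Prop) : compact K ->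
  (forall a, K a -> exists2 r : R, 0 < r &
    forall u v, d a u < r -> d a v < r -> Q u v) ->
  exists2 e : R, 0 < e &
    forall a u v, K a -> d a u < e -> d a v < e -> Q u v.
Proof.
move=> /compact_near_coveringP cK hQ.
pose P (i : R) (x : T) := forall u v, d x u < i -> d x v < i -> Q u v.
have : \forall i \near 0^'+, K `<=` P i.
  apply: cK => x Kx; have [r r0 rQ] := hQ _ Kx.
  have r2 : 0 < r / 2 by rewrite divr_gt0.
  exists ([set y | d x y < r / 2], [set i | i < r / 2]) => /=.
    split; first exact: cmetric_nbhs_ball.
    exact: nbhs_right_lt.
  case=> y i /= [xy ir] u v yu yv; apply: rQ.
    by have := cmetric_tri y x u; lra.
  by have := cmetric_tri y x v; lra.
move=> near_e.
have [e [he e0]] : exists e : R, K `<=` P e /\ 0 < e.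
  apply: (@filter_ex _ (0 : R)^'+).
  by apply: filterI near_e _; exact: nbhs_right_gt.
by exists e => // a u v Ka; exact: he.
Qed.

Lemma compact_open_thicken (K U : set T) : compact K -> open U -> K `<=` U ->
  exists2 e : R, 0 < e & forall a u, K a -> d a u < e -> U u.
Proof.
move=> cK /cmetric_openP oU KU.
have [|e e0 he] := @lebesgue_number K (fun u _ => U u) cK.
  by move=> a /KU /oU [r r0 rU]; exists r => // u v /rU.
by exists e => // a u Ka au; exact: (he a u u).
Qed.

End CompatibleMetric.

Definition thicken {R : realType} {T : Type} (d : T -> T -> R) (K : set T)
  (r : R) : set T := [set x | exists2 a, K a & d a x < r].

Section MoreMetric.
Context {R : realType} {T : topologicalType} {d : T -> T -> R}.
Hypothesis hd : compatible_metric d.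

Lemma open_thicken K r : open (thicken d K r).
Proof.
apply/(cmetric_openP hd) => x [a Ka ax]; exists (r - d a x).
  by rewrite subr_gt0.
by move=> y xy; exists a => //; have := cmetric_tri hd x a y; lra.
Qed.

Lemma sub_thicken K r : 0 < r -> K `<=` thicken d K r.
Proof. by move=> r0 x Kx; exists x; rewrite ?(cmetric_refl hd). Qed.

Context {T' : topologicalType} {d' : T' -> T' -> R}.
Hypothesis hd' : compatible_metric d'.

Lemma cmetric_continuousP (f : T -> T') x :
  {for x, continuous f} <->
  forall e : R, 0 < e -> exists2 r : R, 0 < r &
    forall y, d x y < r -> d' (f x) (f y) < e.
Proof.
split=> [cf e e0|h A].
  have : nbhs x (f @^-1` [set z | d' (f x) z < e]).
    exact: (cf _ (cmetric_nbhs_ball hd' (f x) e0)).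
  by move=> /(cmetric_nbhsP hd).
move=> /(cmetric_nbhsP hd') [e e0 eA]; apply/(cmetric_nbhsP hd).
by have [r r0 hr] := h _ e0; exists r => // y /hr /eA.
Qed.

Lemma compact_unif_continuous (K : set T) (f : T -> T') : compact K ->
  (forall x, K x -> {for x, continuous f}) -> forall e : R, 0 < e ->
  exists2 r : R, 0 < r & forall a u v, K a -> d a u < r -> d a v < r ->
    d' (f u) (f v) < e.
Proof.
move=> cK cf e e0; apply: lebesgue_number => // a Ka.
have e2 : 0 < e / 2 by rewrite divr_gt0.
have /cmetric_continuousP/(_ _ e2) [r r0 hr] := cf _ Ka.
exists r => // u v /hr au /hr av.
by have := cmetric_tri hd' (f a) (f u) (f v); rewrite (cmetric_sym hd' (f u) (f a)); lra.
Qed.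

Lemma cmetric_unif_continuous (f : T -> T') : compact [set: T] -> continuous f ->
  forall e : R, 0 < e -> exists2 r : R, 0 < r & forall u v, d u v < r ->
    d' (f u) (f v) < e.
Proof.
move=> cT cf e e0.
have [r r0 hr] := @compact_unif_continuous _ f cT (fun x _ => cf x) _ e0.
by exists r => // u v uv; apply: (hr u) => //; rewrite (cmetric_refl hd).
Qed.

End MoreMetric.

Lemma mdist_compatible (R : realType) (X : metricType R) :
  compatible_metric (@mdist R X).
Proof.
split; first split.
- by move=> x y; split=> [/mdist_positivity//|->]; exact: mdistxx.
- exact: metric_sym.
- by move=> x y z; exact: metric_triangle.
move=> x A; split.
  by move=> /nbhs_ballP [r /= r0 rA]; exists r => //; rewrite -ballEmdist.
by move=> [r r0 rA]; apply/nbhs_ballP; exists r => //; rewrite ballEmdist.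
Qed.

Lemma norm_compatible (R : realType) (V : normedModType R) :
  compatible_metric (fun x y : V => `|x - y|).
Proof.
split; first split.
- move=> x y; split=> [/normr0_eq0/eqP|->]; last by rewrite subrr normr0.
  by rewrite subr_eq0 => /eqP.
- by move=> x y; rewrite distrC.
- by move=> x y z; exact: ler_distD.
move=> x A; split.
  by move=> /nbhs_normP [r /= r0 rA]; exists r => // y /= xy; exact: rA.
by move=> [r r0 rA]; apply/nbhs_normP; exists r.
Qed.

(** * Homeomorphisms of compact spaces and uniform limits *)

(** On a compact space the inverse is continuous for free, so that only
bijectivity and continuity have to be checked in the constructions below. *)
Lemma compact_bij_homeomorphism (X Y : topologicalType) (f : X -> Y) :
  compact [set: X] -> hausdorff_space Y -> continuous f -> injective f ->
  (forall y, exists x, f x = y) -> exists g, homeomorphism f g.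
Proof.
move=> cX hY cf finj fsurj.
have [g fg] := choice fsurj; exists g.
have gf : cancel f g by move=> x; apply: finj; rewrite fg.
split=> //; apply/continuous_closedP => A cA.
rewrite (_ : g @^-1` A = f @` A).
  apply: compact_closed hY _; apply: continuous_compact; last first.
    exact: subclosed_compact cA cX _.
  exact: continuous_subspaceT.
apply/seteqP; split=> [y /= Agy|_ [x Ax <-]]; first by exists (g y).
by rewrite /= gf.
Qed.

Lemma homeomorphism_id (X : topologicalType) : @homeomorphism X X id id.
Proof. by split=> // x; exact: cvg_id. Qed.

Lemma homeomorphism_comp (X Y Z : topologicalType) (f : X -> Y) f' (g : Y -> Z) g' :
  homeomorphism f f' -> homeomorphism g g' ->
  homeomorphism (g \o f) (f' \o g').
Proof.
move=> [ff' f'f cf cf'] [gg' g'g cg cg']; split.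
- by move=> x /=; rewrite gg' ff'.
- by move=> x /=; rewrite f'f g'g.
- by move=> x; apply: continuous_comp; [exact: cf|exact: cg].
- by move=> x; apply: continuous_comp; [exact: cg'|exact: cf'].
Qed.

Lemma homeomorphism_sym (X Y : topologicalType) (f : X -> Y) g :
  homeomorphism f g -> homeomorphism g f.
Proof. by case. Qed.

(** Completeness of a compact space. The rate is kept because both limits
constructed below are controlled through it. *)
Lemma cmetric_limit (R : realType) (X : Type) (Y : topologicalType)
    (d : Y -> Y -> R) (f : nat -> X -> Y) (r : nat -> R) :
  compatible_metric d -> compact [set: Y] ->
  (forall e, 0 < e -> exists n, r n < e) ->
  (forall n m x, (n <= m)%N -> d (f n x) (f m x) <= r n) ->
  exists p : X -> Y, forall n x, d (f n x) (p x) <= r n.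
Proof.
move=> hd cY r0 fr.
suff : forall x, exists y, forall n, d (f n x) y <= r n.
  by move=> /choice [p hp]; exists p.
move=> x.
have [y [_ cly]] := cY ((fun n => f n x) @ \oo) _ (@filterT _ _ _).
exists y => n; apply/ler_addgt0Pr => e e0.
have [] := cly [set z | exists2 m, (n <= m)%N & z = f m x] [set z | d y z < e].
- by exists n => // m /= nm; exists m.
- exact: cmetric_nbhs_ball.
move=> _ [[m nm ->] ym].
have := cmetric_tri hd (f m x) (f n x) y.
have := fr n m x nm.
by rewrite (cmetric_sym hd (f m x) y); move: ym => /=; lra.
Qed.

Lemma cmetric_limit_continuous (R : realType) (X Y : topologicalType)
    (d : Y -> Y -> R) (f : nat -> X -> Y) (r : nat -> R) (p : X -> Y) :
  compatible_metric d -> (forall e, 0 < e -> exists n, r n < e) ->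
  (forall n, continuous (f n)) -> (forall n x, d (f n x) (p x) <= r n) ->
  continuous p.
Proof.
move=> hd r0 cf fp x A /(cmetric_nbhsP hd) [e e0 eA].
have e3 : 0 < e / 3 by rewrite divr_gt0.
have [n rn] := r0 _ e3.
have : nbhs x [set y | d (f n x) (f n y) < e / 3].
  exact: (cf n x _ (cmetric_nbhs_ball hd _ e3)).
apply: filterS => y /= xy; apply: eA.
have := cmetric_tri hd (f n x) (p x) (p y).
have := cmetric_tri hd (f n y) (f n x) (p y).
have := fp n x; have := fp n y.
by rewrite (cmetric_sym hd (p x) (f n x)); lra.
Qed.

Lemma cmetric_limit_surjective (R : realType) (X Y : topologicalType)
    (d : Y -> Y -> R) (f : nat -> X -> Y) (r : nat -> R) (p : X -> Y) :
  compatible_metric d -> compact [set: X] ->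
  (forall e, 0 < e -> exists n, r n < e) ->
  (forall n y, exists x, f n x = y) -> continuous p ->
  (forall n x, d (f n x) (p x) <= r n) -> forall y, exists x, p x = y.
Proof.
move=> hd cX r0 fs cp fp y; apply: contrapT => ny.
have clp : closed (p @` [set: X]).
  apply: (cmetric_compact_closed hd); apply: continuous_compact => //.
  exact: continuous_subspaceT.
have [e e0 eB] := (cmetric_openP hd _).1 (closed_openC clp) y
  (fun '(ex_intro2 x _ px) => ny (ex_intro _ x px)).
have [n rn] := r0 _ e0; have [x fx] := fs n y.
by apply: (eB (p x)); [rewrite -fx; exact: le_lt_trans (fp _ _) rn|exists x].
Qed.

(** * Slowly varying profiles *)

Section SlowProfile.
Variable R : realType.

(** Piecewise linear: [0] up to [t] and [1] from [2 * t] on. *)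
Definition ramp (t a : R) : R := (`|a / t - 1| - `|a / t - 2| + 1) / 2.

Lemma ramp_continuous t : continuous (ramp t).
Proof.
have c k : continuous (fun a : R => `|a / t - k|).
  move=> a; apply: cvg_norm.
  by apply: cvgB; [apply: cvgMl; exact: cvg_id|exact: cvg_cst].
move=> a; apply: cvgMl; apply: cvgD; last exact: cvg_cst.
by apply: cvgB; exact: c.
Qed.

Lemma ramp_homo t : 0 < t -> {homo ramp t : a b / a <= b}.
Proof.
move=> t0 a b ab; rewrite /ramp.
have : a / t <= b / t by rewrite ler_pM2r// invr_gt0.
move: (a / t) (b / t) => {}a {}b {}ab.
by do 4!case: ler0P => ?; lra.
Qed.

Lemma ramp_itv t a : 0 <= ramp t a <= 1.
Proof. by rewrite /ramp; move: (a / t) => {}a; do 2!case: ler0P => ?; lra. Qed.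

Lemma ramp0 t a : 0 < t -> a <= t -> ramp t a = 0.
Proof.
move=> t0; rewrite -{1}[t]mul1r -ler_pdivrMr// /ramp.
by move: (a / t) => {}a at1; do 2!case: ler0P => ?; lra.
Qed.

Lemma ramp1 t a : 0 < t -> t * 2 <= a -> ramp t a = 1.
Proof.
move=> t0; rewrite mulrC -ler_pdivlMr// /ramp.
by move: (a / t) => {}a at1; do 2!case: ler0P => ?; lra.
Qed.

(** Each new unit of height is gained on an interval chosen so close to [0] that
two related numbers, one of which lies in it, both lie where the profile built
before still vanishes; thus every related pair sees at most one of the [N] steps. *)
Lemma slow_profile (rel : R -> R -> Prop) :
  (forall a b, rel a b -> rel b a) ->
  (forall r, 0 < r -> exists2 r', 0 < r' &
    forall a b, rel a b -> a < r' -> b < r) ->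
  forall (N : nat) (rho : R), 0 < rho -> exists L : R -> R,
    [/\ continuous L, {homo L : a b / a <= b},
      exists2 r, 0 < r <= rho & forall a, a <= r -> L a = 0,
      forall a, rho <= a -> L a = N%:R &
      forall a b, rel a b -> `|L a - L b| <= 1].
Proof.
move=> rsym rmod N rho rho0; elim: N => [|N [L [cL hL [r /andP[r0 rrho] Lr] Lrho Lrel]]].
  exists (fun=> 0); split=> //.
  - exact: cst_continuous.
  - by exists rho => //; rewrite rho0 lexx.
  - by move=> a b _; rewrite subrr normr0.
have [r1 r10 hr1] := rmod _ r0.
pose t := Num.min r1 r / 2.
have t0 : 0 < t by rewrite divr_gt0// lt_min r10.
have tr : t * 2 <= r by rewrite divfK// ge_min lexx orbT.
have tr1 : t * 2 <= r1 by rewrite divfK// ge_min lexx.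
have rampab a b : `|ramp t a - ramp t b| <= 1.
  by have := ramp_itv t a; have := ramp_itv t b; rewrite ler_norml; lra.
exists (fun a => L a + ramp t a); split.
- by move=> a; apply: cvgD; [exact: cL|exact: ramp_continuous].
- by move=> a b ab; rewrite lerD ?hL// ramp_homo.
- exists t; first by rewrite t0/=; lra.
  by move=> a ha; rewrite ramp0// Lr ?addr0//; lra.
- by move=> a ha; rewrite Lrho// ramp1 -?natr1//; lra.
- move=> a b ab.
  have [ta|ta] := ltP a (t * 2).
    rewrite (Lr a) ?(Lr b) ?add0r//; last by lra.
    by apply/ltW/(hr1 _ _ ab); lra.
  have [tb|tb] := ltP b (t * 2).
    rewrite (Lr b) ?(Lr a) ?add0r//; last by lra.
    by apply/ltW/(hr1 _ _ (rsym _ _ ab)); lra.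
  by rewrite !ramp1// opprD addrACA subrr addr0; exact: Lrel.
Qed.

End SlowProfile.

(** * Radial contractions towards a starlike set *)

Section DistanceToSet.
Context {R : realType} {V : normedModType R}.
Implicit Types (S : set V) (x y : V).

Definition dist_to S x : R := inf [set `|x - s| | s in S].

Lemma dist_to_le S x s : S s -> dist_to S x <= `|x - s|.
Proof.
move=> Ss; apply: ge_inf; last by exists s.
by exists 0 => _ [z _ <-].
Qed.

Lemma dist_to_ltP S x r : S !=set0 ->
  dist_to S x < r <-> exists2 s, S s & `|x - s| < r.
Proof.
move=> S0; split=> [ur|[s Ss sr]]; last exact: le_lt_trans (dist_to_le x Ss) sr.
case: S0 => s0 Ss0.
have ne : [set `|x - s| | s in S] !=set0 by exists `|x - s0|; exists s0.
by have [_ [s Ss <-] sr] := inf_lt ne ur; exists s.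
Qed.

Lemma dist_to_ge0 S x : S !=set0 -> 0 <= dist_to S x.
Proof.
move=> [s Ss]; apply: lb_le_inf; first by exists `|x - s|; exists s.
by move=> _ [z _ <-].
Qed.

Lemma dist_to_eq0 S s : S s -> dist_to S s = 0.
Proof.
move=> Ss; apply/eqP; rewrite eq_le dist_to_ge0 ?andbT; last by exists s.
by have := dist_to_le s Ss; rewrite subrr normr0.
Qed.

Lemma dist_to_lip S x y : S !=set0 -> dist_to S x <= dist_to S y + `|x - y|.
Proof.
move=> S0; apply/ler_addgt0Pr => e e0.
have [|s Ss sy] := (dist_to_ltP y (dist_to S y + e) S0).1; first by rewrite ltrDl.
apply: le_trans (dist_to_le x Ss) _.
by have := ler_distD y x s; lra.
Qed.

Lemma dist_to_continuous S : S !=set0 -> continuous (dist_to S).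
Proof.
move=> S0 x.
apply/(cmetric_continuousP (norm_compatible V) (norm_compatible R^o)) => e e0.
exists e => // y xy; apply: le_lt_trans xy; rewrite ler_distlC.
have := dist_to_lip x y S0; have := dist_to_lip y x S0.
by rewrite (distrC y x); lra.
Qed.

(** Shrinking towards the centre carries a nearest point of the starlike set to a
point of that set, and does not increase the distance. *)
Lemma dist_to_ray S x0 x t : S x0 ->
  (forall y, S y -> forall t, 0 <= t <= 1 -> S ((1 - t) *: x0 + t *: y)) ->
  0 <= t <= 1 -> dist_to S (x0 + t *: (x - x0)) <= dist_to S x.
Proof.
move=> Sx0 starS t01; apply/ler_addgt0Pr => e e0.
have [|s Ss sx] := (dist_to_ltP x (dist_to S x + e) (ex_intro _ x0 Sx0)).1.
  by rewrite ltrDl.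
apply: le_trans (dist_to_le _ (starS _ Ss _ t01)) _.
rewrite (_ : _ - _ = t *: (x - s)); last first.
  by rewrite scalerBl scale1r !scalerBr addrA addrAC opprD addrACA subrr add0r.
rewrite normrZ ger0_norm; last by case/andP: t01.
have := normr_ge0 (x - s).
by case/andP: t01 => t0 t1; nra.
Qed.

End DistanceToSet.

Section RadialMap.
Context {R : realType} {V : normedModType R}.
Variables (x0 : V) (lam : V -> R) (c : R).
Hypothesis c0 : 0 < c.
Hypothesis lam_itv : forall x, c <= lam x <= 1.
Hypothesis lam_cont : continuous lam.
Hypothesis lam_ray :
  forall x t, 0 <= t <= 1 -> lam (x0 + t *: (x - x0)) <= lam x.

Definition radial (x : V) : V := x0 + lam x *: (x - x0).

Lemma radial_continuous : continuous radial.
Proof.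
move=> x; apply: cvgD; first exact: cvg_cst.
apply: cvgZ; first exact: lam_cont.
by apply: cvgB; [exact: cvg_id|exact: cvg_cst].
Qed.

Lemma lam_gt0 x : 0 < lam x.
Proof. by apply: lt_le_trans c0 _; case/andP: (lam_itv x). Qed.

Lemma radial_injective : injective radial.
Proof.
suff wlg x y : radial x = radial y -> lam x <= lam y -> x = y.
  move=> x y xy; have [/(wlg _ _ xy)//|/ltW h] := leP (lam x) (lam y).
  by apply/esym/wlg.
move=> /addrI xy lxy.
have lx := lam_gt0 x; have ly := lam_gt0 y.
have yE : y = x0 + (lam x / lam y) *: (x - x0).
  by rewrite mulrC -scalerA xy scalerA mulVf ?gt_eqF// scale1r subrKC.
have t01 : 0 <= lam x / lam y <= 1.
  apply/andP; split; first by apply: divr_ge0; exact: ltW.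
  by rewrite ler_pdivrMr// mul1r.
have := lam_ray x t01; rewrite -yE => lyx.
have lE : lam x = lam y by apply/eqP; rewrite eq_le lxy lyx.
by rewrite yE lE divff ?gt_eqF// scale1r subrKC.
Qed.

Lemma radial_surjective y : exists x, radial x = y.
Proof.
pose f (t : R) := t * lam (x0 + t *: (y - x0)).
have cf : continuous f.
  move=> t; apply: cvgM; first exact: cvg_id.
  apply: continuous_comp; last exact: lam_cont.
  apply: cvgD; first exact: cvg_cst.
  by apply: cvgZ; [exact: cvg_id|exact: cvg_cst].
have c1 : c <= 1 by case/andP: (lam_itv x0) => /le_trans; apply.
have h1 : 1 <= c^-1 by rewrite invf_ge1.
have f1 : f 1 <= 1 by rewrite /f mul1r; case/andP: (lam_itv (x0 + 1 *: (y - x0))).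
have fc : 1 <= f c^-1.
  rewrite /f ler_pdivlMl ?mulr1//.
  by case/andP: (lam_itv (x0 + c^-1 *: (y - x0))).
have [|t _ ft] := @IVT R f 1 c^-1 1 h1 (continuous_subspaceT cf).
  by rewrite ge_min f1 le_max fc orbT.
exists (x0 + t *: (y - x0)).
rewrite /radial [x0 + t *: _ - x0]addrC addrA addNr add0r scalerA mulrC.
by rewrite -/(f t) ft scale1r subrKC.
Qed.

Lemma radial_dist x y :
  `|radial x - radial y| <= `|x - y| + `|lam x - lam y| * `|y - x0|.
Proof.
rewrite (_ : radial x - radial y =
    lam x *: (x - y) + (lam x - lam y) *: (y - x0)); last first.
  by rewrite /radial opprD addrACA subrr add0r scalerBl addrA -scalerDr addrA subrK.
apply: le_trans (ler_normD _ _) _; rewrite !normrZ lerD2r.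
rewrite (gtr0_norm (lam_gt0 x)) ler_piMl//.
by case/andP: (lam_itv x).
Qed.

End RadialMap.

(** * Shrinking a starlike-equivalent set *)

Section NullShrinkable.
Context {R : realType}.

Definition small {T : Type} (d : T -> T -> R) (e : R) (C : set T) :=
  forall x y, C x -> C y -> d x y < e.

(** A local form of nullness, stable under passing to a smaller set and to the
image under a collapsing map. *)
Definition null_at {T : topologicalType} (d : T -> T -> R) (A : set T)
    (H : set (set T)) :=
  forall e : R, 0 < e -> exists W : set T,
    [/\ open W, A `<=` W & forall C, H C -> C `&` W !=set0 -> small d e C].

(** The family [H] and the alternative in the last clause allow one element of a
decomposition to be shrunk without enlarging the others; they are also what the
induction along a filtration has to carry through. *)
Definition null_shrinkable {T : topologicalType} (d : T -> T -> R)
    (A : set T) :=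
  forall (H : set (set T)) (U : set T) (e : R),
    null_at d A H -> open U -> A `<=` U -> 0 < e ->
    exists h k : T -> T,
      [/\ homeomorphism h k,
          forall x, ~ U x -> h x = x,
          small d e (h @` A) &
          forall C, H C -> small d e (h @` C) \/ forall x, C x -> h x = x].

End NullShrinkable.

Lemma embedding_on_openI (X Y : topologicalType) (U W : set X) (e : X -> Y) :
  open W -> embedding_on U e -> open (e @` U) ->
  embedding_on (U `&` W) e /\ open (e @` (U `&` W)).
Proof.
move=> oW [einj ec eop] oeU; split; last first.
  by have [V oV ->] := eop _ oW; exact: openI.
split.
- by move=> x y /[!inE] -[Ux _] [Uy _]; apply: einj; rewrite inE.
- by apply: continuous_subspaceW ec; exact: subIsetl.
move=> W' oW'; have [V oV eV] := eop _ (openI oW oW'); exists V => //.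
rewrite -setIA eV; apply/seteqP; split=> y [].
  move=> eUy Vy; have : (e @` U `&` V) y by split.
  by rewrite -eV => -[x [Ux [Wx _]] xy]; split=> //; exists x.
by move=> [x [Ux _] xy] Vy; split=> //; exists x.
Qed.

Section StarlikeShrink.
Context {R : realType} {X : topologicalType} {d : X -> X -> R}.
Hypothesis hd : compatible_metric d.
Variables (A U : set X) (n : nat) (e : X -> 'rV[R]_n).
Hypothesis oU : open U.
Hypothesis AU : A `<=` U.
Hypothesis eU : embedding_on U e.
Hypothesis oeU : open (e @` U).
Hypothesis cS : compact (e @` A).

Let S := e @` A.
Let u := dist_to S.
Let dn := norm_compatible 'rV[R]_n.

Let e_inj x y : U x -> U y -> e x = e y -> x = y.
Proof. by case: eU => einj _ _ Ux Uy; apply: einj; rewrite inE. Qed.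

Lemma embedding_continuous_at x : U x -> {for x, continuous e}.
Proof.
case: eU => _ ec _ Ux.
by move: ec; rewrite continuous_open_subspace// => /(_ x); apply; rewrite inE.
Qed.

(** A member of a family null at [A] that comes near [A] is small, so that a
local property of pairs holds for all pairs of its points. Closeness to [A] is measured
in the chart because the scaling factor of the radial map is a function of that
distance. *)
Lemma null_at_chart (H : set (set X)) (Q : X -> X -> Prop) :
  S !=set0 -> null_at d A H ->
  (forall a, A a -> exists2 r : R, 0 < r &
    forall y z, d a y < r -> d a z < r -> Q y z) -> compact A ->
  exists2 r : R, 0 < r & forall C x, H C -> C x -> U x -> u (e x) < r ->
    forall y z, C y -> C z -> Q y z.
Proof.
move=> S0 Hnull hQ cA.
have [eta eta0 etaQ] := lebesgue_number hd cA hQ.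
have eta2 : 0 < eta / 2 by rewrite divr_gt0.
have [W [oW AW WH]] := Hnull _ eta2.
have [_ _ eop] := eU.
pose W' := W `&` thicken d A (eta / 2).
have oW' : open W' by apply: openI => //; exact: open_thicken.
have oeW : open (e @` (U `&` W')).
  by have [V oV ->] := eop _ oW'; exact: openI.
have SW : S `<=` e @` (U `&` W').
  move=> _ [a Aa <-]; exists a => //.
  by split; [exact: AU|split; [exact: AW|exact: (sub_thicken hd)]].
have [r r0 rS] := compact_open_thicken dn cS oeW SW.
exists r => // C x HC Cx Ux /(dist_to_ltP _ _ S0) [s Ss sx] y z Cy Cz.
have [x' [Ux' [Wx' [a Aa ax']]] /e_inj ex'] : (e @` (U `&` W')) (e x).
  by apply: rS Ss _; rewrite distrC.
have {ex'} xx' : x' = x by exact: ex'.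
rewrite xx' in Wx' ax'.
have sC : small d (eta / 2) C by apply: WH => //; exists x.
have tri w : C w -> d a w < eta.
  by move=> Cw; have := cmetric_tri hd x a w; have := sC _ _ Cx Cw; lra.
by apply: (etaQ a) => //; exact: tri.
Qed.

Lemma chart_local (Q : X -> X -> Prop) a : A a ->
  (exists2 r : R, 0 < r & forall y z, U y -> U z ->
     `|e a - e y| < r -> `|e a - e z| < r -> Q y z) ->
  exists2 r : R, 0 < r & forall y z, d a y < r -> d a z < r -> Q y z.
Proof.
move=> Aa [r r0 hr].
have [r1 r10 hr1] := (cmetric_openP hd U).1 oU a (AU Aa).
have [r2 r20 hr2] :=
  (cmetric_continuousP hd dn e a).1 (embedding_continuous_at (AU Aa)) r r0.
exists (Num.min r1 r2); first by rewrite lt_min r10.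
move=> y z; rewrite !lt_min => /andP[y1 y2] /andP[z1 z2].
by apply: hr; [exact: hr1|exact: hr1|exact: hr2|exact: hr2].
Qed.

Lemma chart_inverse : A !=set0 -> exists g : 'rV[R]_n -> X,
  [/\ forall x, U x -> g (e x) = x,
      forall v, (e @` U) v -> U (g v) /\ e (g v) = v &
      forall v, (e @` U) v -> {for v, continuous g}].
Proof.
move=> [a0 Aa0].
have [g hg] : {g & forall v, (e @` U) v -> U (g v) /\ e (g v) = v}.
  apply: (@choice _ _ (fun v x => (e @` U) v -> U x /\ e x = v)) => v.
  have [[x Ux xv]|nv] := pselect ((e @` U) v); first by exists x.
  by exists a0.
have ge x : U x -> g (e x) = x.
  move=> Ux; have [Ug eg] : U (g (e x)) /\ e (g (e x)) = e x.
    by apply: hg; exists x.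
  exact: e_inj.
exists g; split=> // v [x Ux xv]; rewrite -{v}xv.
move=> B; rewrite ge// => xB.
have [_ _ eop] := eU.
have [V oV eV] := eop _ (open_interior B).
have : nbhs (e x) (e @` U `&` V).
  apply: open_nbhs_nbhs; split; first exact: openI.
  by rewrite -eV; exists x.
apply: filterS => w; rewrite -eV => -[y [Uy By] <-].
by rewrite /= ge//; exact: interior_subset.
Qed.

End StarlikeShrink.

Lemma starlike_thicken_compact (R : realType) n (S : set 'rV[R]_n) r :
  compact S -> S !=set0 -> compact [set v | dist_to S v <= r].
Proof.
move=> cS S0.
apply: bounded_closed_compact; last first.
  apply: (@closed_comp _ _ (dist_to S) [set x | x <= r]).
    by move=> v _; exact: dist_to_continuous.
  exact: closed_le.
have [M [Mr hM]] := compact_bounded cS.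
exists (M + 1 + (r + 1)); split; first by rewrite num_real.
move=> m hm v /= vr.
have [|s Ss vs] := (dist_to_ltP v (r + 1) S0).1; first by lra.
have hs : `|s| <= M + 1 by apply: hM => //; lra.
have := ler_normD s (v - s); rewrite subrKC.
by lra.
Qed.

(** Push the points near [A] radially towards the centre of the star, the scaling
factor being a function of the distance to the star. Two points of one member of the
family have related distances in the sense of [slow_profile], so they are
scaled by almost the same factor and the image of a small member stays small,
although the star itself is scaled down to a tiny copy. *)
Lemma starlike_null_shrinkable (R : realType) (X : topologicalType)
    (d : X -> X -> R) (A : set X) :
  compatible_metric d -> compact [set: X] -> starlike_equivalent R A ->
  null_shrinkable d A.
Proof.
move=> hd cX sA H U eps Hnull oU AU eps0.
have cA : compact A := starlike_equivalent_compact sA.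
case: sA => U0 [n [e [oU0 AU0 eU0 oeU0 [cS [s0 Ss0 starS]]]]].
have [eU' oeU'] := embedding_on_openI oU eU0 oeU0.
pose U' := U0 `&` U.
have oU' : open U' by exact: openI.
have AU' : A `<=` U' by move=> x Ax; split; [exact: AU0|exact: AU].
have A0 : A !=set0 by case: Ss0 => a Aa _; exists a.
have [g [ge hg gc]] := chart_inverse eU' oeU' A0.
pose S := e @` A; pose u := dist_to S.
have S0 : S !=set0 by exists s0.
have dn := norm_compatible 'rV[R]_n.
have SE : S `<=` e @` U' by move=> _ [a Aa <-]; exists a => //; exact: AU'.
have [rho0 rho00 hrho0] := compact_open_thicken dn cS oeU' SE.
have uE v : u v < rho0 -> (e @` U') v.
  move=> /(dist_to_ltP _ _ S0) [s Ss sv].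
  by apply: hrho0 Ss _; rewrite distrC.
pose K := [set v | u v <= rho0 / 2].
have cK : compact K by exact: starlike_thicken_compact.
have KE v : K v -> (e @` U') v by rewrite /K /= => Kv; apply: uE; lra.
have [del del0 hdel] :=
  compact_unif_continuous dn hd cK (fun v Kv => gc v (KE v Kv)) eps0.
have gdel v w : K v -> `|v - w| < del -> d (g v) (g w) < eps.
  by move=> Kv vw; apply: (hdel v) => //; rewrite subrr normr0.
have [M M0 hM] : exists2 M : R, 0 < M & forall v, K v -> `|v - s0| <= M.
  have [M [_ hM]] := compact_bounded cK.
  exists (Num.max 1 (M + 1) + `|s0|) => [|v Kv].
    by rewrite ltr_wpDr// lt_max ltr01.
  have : `|v| <= M + 1 by apply: hM => //; rewrite ltrDl.
  have := ler_normB v s0.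
  have : M + 1 <= Num.max 1 (M + 1) by rewrite le_max lexx orbT.
  by lra.
(* [c] shrinks the star, whose diameter is at most [2 * M], to size below [del]. *)
pose c := del / (2 * M + 2 * del).
have cden : 0 < 2 * M + 2 * del by lra.
have c0 : 0 < c by rewrite divr_gt0.
have c1 : c < 1 by rewrite ltr_pdivrMr//; lra.
have cM : c * (2 * M) < del.
  by rewrite mulrAC ltr_pdivrMr//; nra.
(* With a profile rising in [N] unit steps, the variation of the scaling factor on
   one member displaces points by at most [M / N]. *)
pose N := (Num.bound (2 * M / del)).+1.
have N0 : 0 < N%:R :> R by rewrite ltr0n.
have NM : M / N%:R < del / 2.
  rewrite ltr_pdivrMr//.
  have : 2 * M / del < N%:R.
    apply: lt_le_trans (archi_boundP _) _; first by rewrite divr_ge0//; lra.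
    by rewrite ler_nat.
  by rewrite ltr_pdivrMr//; lra.
pose rel (a b : R) := exists C, H C /\ exists x y,
  [/\ C x, C y, U' x, U' y & a = u (e x) /\ b = u (e y)].
have rel_sym a b : rel a b -> rel b a.
  by move=> [C [HC [x [y [Cx Cy Ux Uy [? ?]]]]]]; exists C; split=> //; exists y, x.
have ue a y : A a -> u (e y) <= `|e a - e y|.
  by move=> Aa; rewrite distrC; apply: dist_to_le; exists a.
have chart Q := @null_at_chart R X d hd A U' n e AU' eU' oeU' cS H Q S0 Hnull.
have rel_mod r : 0 < r -> exists2 r', 0 < r' & forall a b, rel a b -> a < r' -> b < r.
  move=> r0; have [|//|r' r'0 hr'] := chart (fun y _ => U' y -> u (e y) < r).
    move=> a Aa; apply: (chart_local hd oU' AU' eU' Aa); exists r => // y z _ _ ay _ _.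
    exact: le_lt_trans (ue _ _ Aa) ay.
  exists r' => // a b [C [HC [x [y [Cx Cy Ux Uy [-> ->]]]]]] xr'.
  exact: (hr' C x HC Cx Ux xr' y y).
have [r1 r10 hr1] : exists2 r : R, 0 < r & forall C x, H C -> C x -> U' x ->
    u (e x) < r -> forall y z, C y -> C z ->
    [/\ U' y, u (e y) < rho0 / 2 & `|e y - e z| < del / 2].
  apply: chart => // a Aa; apply: (chart_local hd oU' AU' eU' Aa).
  exists (Num.min (rho0 / 2) (del / 4)); first by rewrite lt_min !divr_gt0.
  move=> y z Uy Uz; rewrite !lt_min => /andP[y1 y2] /andP[z1 z2]; split=> //.
    exact: le_lt_trans (ue _ _ Aa) y1.
  by have := ler_distD (e a) (e y) (e z); rewrite (distrC (e y) (e a)); lra.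
pose rho := Num.min r1 (rho0 / 2).
have rho_gt0 : 0 < rho by rewrite lt_min r10 divr_gt0.
have rhor1 : rho <= r1 by rewrite ge_min lexx.
have rhorho0 : rho <= rho0 / 2 by rewrite ge_min lexx orbT.
have [L [cL hL [r2 /andP[r20 r2rho] Lr2] Lrho Lrel]] :=
  slow_profile rel_sym rel_mod N rho_gt0.
have u0 v : 0 <= u v by exact: dist_to_ge0.
have L_itv v : 0 <= L (u v) / N%:R <= 1.
  rewrite divr_ge0 ?ler0n//=; last first.
    by rewrite -(Lr2 0 (ltW r20)) hL.
  rewrite ler_pdivrMr// mul1r.
  have [ur|ur] := leP rho (u v); first by rewrite Lrho.
  by rewrite -(Lrho rho (lexx _)) hL// ltW.
pose lam v := c + (1 - c) * (L (u v) / N%:R).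
have lam_itv v : c <= lam v <= 1 by rewrite /lam; have := L_itv v; nra.
have lam_cont : continuous lam.
  have cl : continuous (fun a => c + (1 - c) * (L a / N%:R)).
    move=> a; apply: cvgD; first exact: cvg_cst.
    by apply: cvgMr; apply: cvgMl; exact: cL.
  move=> v.
  exact: (@continuous_comp _ _ _ u _ v (@dist_to_continuous _ _ S S0 v) (cl _)).
have u_ray v t : 0 <= t <= 1 -> u (s0 + t *: (v - s0)) <= u v.
  by move=> t01; exact: dist_to_ray.
have lam_ray v t : 0 <= t <= 1 -> lam (s0 + t *: (v - s0)) <= lam v.
  move=> t01; rewrite lerD2l; apply: ler_wpM2l; first by rewrite subr_ge0 ltW.
  by rewrite ler_pM2r ?invr_gt0//; apply: hL; exact: u_ray.
pose phi := radial s0 lam.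
have phi_inj : injective phi := radial_injective c0 lam_itv lam_ray.
have phi_cont : continuous phi := radial_continuous lam_cont.
have phi_id v : rho <= u v -> phi v = v.
  move=> uv; rewrite /phi /radial /lam Lrho// divff ?gt_eqF//.
  by rewrite mulr1 subrKC scale1r subrKC.
have u_phi v : u (phi v) <= u v.
  by apply: u_ray; have := lam_itv v; lra.
have phi_E v : (e @` U') v -> (e @` U') (phi v).
  move=> Ev; have [/phi_id->//|uv] := leP rho (u v).
  by apply: uE; have := u_phi v; lra.
pose h x := if pselect (U' x) then g (phi (e x)) else x.
have hU x : U' x -> h x = g (phi (e x)) by rewrite /h; case: pselect.
have hNU x : ~ U' x -> h x = x by rewrite /h; case: pselect.
have ehU x : U' x -> U' (h x) /\ e (h x) = phi (e x).
  by move=> Ux; rewrite hU//; apply: hg; apply: phi_E; exists x.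
have h_id x : (U' x -> rho <= u (e x)) -> h x = x.
  move=> hx; have [Ux|/hNU//] := pselect (U' x).
  by rewrite hU// phi_id ?ge// hx.
have h_inj : injective h.
  move=> x y; have [Ux|Ux] := pselect (U' x); have [Uy|Uy] := pselect (U' y).
  - move=> hxy; have [_ ex] := ehU _ Ux; have [_ ey] := ehU _ Uy.
    rewrite -[x]ge// -[y]ge//; congr g; apply: phi_inj.
    by rewrite -ex -ey hxy.
  - by rewrite (hNU y)// => hxy; case: Uy; rewrite -hxy; case: (ehU _ Ux).
  - by rewrite (hNU x)// => hxy; case: Ux; rewrite hxy; case: (ehU _ Uy).
  - by rewrite !hNU.
have h_surj y : exists x, h x = y.
  have [Uy|Uy] := pselect (U' y); last by exists y; exact: hNU.
  have [v phiv] := radial_surjective s0 c0 lam_itv lam_cont (e y).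
  have [x Ux xv] : (e @` U') v.
    have [uv|uv] := leP rho (u v); last by apply: uE; lra.
    by exists y => //; rewrite -phiv -/(phi v) phi_id.
  by exists x; rewrite hU// xv /phi phiv ge.
have h_cont : continuous h.
  move=> x; have [Ux|Ux] := pselect (U' x).
    have gx : {for phi (e x), continuous g} by apply/gc/phi_E; exists x.
    have ex := embedding_continuous_at oU' eU' Ux.
    move=> B; rewrite hU// => hB.
    have : nbhs x (e @^-1` (phi @^-1` (g @^-1` B))) by exact/ex/phi_cont/gx.
    have : nbhs x U' by exact: open_nbhs_nbhs.
    by apply: filterS2 => y Uy; rewrite /= hU.
  (* Off the compact set [g @` K] the map [h] is the identity. *)
  have clK : closed (g @` K).
    apply: (cmetric_compact_closed hd); apply: continuous_compact => //.
    by apply: continuous_in_subspaceT => v /set_mem/KE; exact: gc.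
  have : nbhs x (~` (g @` K)).
    apply: open_nbhs_nbhs; split; first exact: closed_openC.
    by move=> [v /KE /hg [Ugv _] gv]; rewrite gv in Ugv.
  move=> nx B; rewrite hNU// => /(filterI nx).
  apply: filterS => y [nKy By] /=; rewrite h_id// => Uy.
  rewrite leNgt; apply/negP => uy; apply: nKy.
  by exists (e y); rewrite ?ge// /K /=; lra.
have [k hk] := compact_bij_homeomorphism cX (cmetric_hausdorff hd) h_cont h_inj h_surj.
have uA x : A x -> u (e x) = 0 by move=> Ax; apply: dist_to_eq0; exists x.
have K_phi v : u v <= rho0 / 2 -> K (phi v) by move=> uv; apply: le_trans (u_phi v) uv.
exists h, k; split=> //.
- by move=> x Ux; apply: hNU => -[].
- move=> _ _ [x Ax <-] [y Ay <-]; rewrite !hU; [|exact: AU'..].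
  apply: gdel; first by apply: K_phi; rewrite uA//; lra.
  have lamA z : A z -> lam (e z) = c.
    by move=> Az; rewrite /lam uA// Lr2 ?mul0r ?mulr0 ?addr0// ltW.
  have KA z : A z -> K (e z) by move=> Az; rewrite /K /= uA//; lra.
  rewrite /phi /radial !lamA// opprD addrACA subrr add0r -scalerBr.
  rewrite normrZ gtr0_norm//; apply: le_lt_trans cM.
  rewrite ler_pM2l//; apply: le_trans (ler_normB _ _) _.
  by have := hM _ (KA _ Ax); have := hM _ (KA _ Ay); lra.
- move=> C HC.
  have [[x [Cx Ux ux]]|far] := pselect (exists x, [/\ C x, U' x & u (e x) < rho]).
    left => _ _ [y Cy <-] [z Cz <-].
    have hC := hr1 C x HC Cx Ux (lt_le_trans ux rhor1).
    have [Uy uy yz] := hC _ _ Cy Cz; have [Uz uz _] := hC _ _ Cz Cy.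
    rewrite !hU//; apply: gdel; first by apply: K_phi; exact: ltW.
    apply: le_lt_trans (radial_dist s0 c0 lam_itv _ _) _.
    have Mz : `|e z - s0| <= M by apply: hM; exact: ltW.
    have L1 : `|L (u (e y)) - L (u (e z))| <= 1.
      by apply: Lrel; exists C; split=> //; exists y, z.
    have lamyz : `|lam (e y) - lam (e z)| <= N%:R^-1.
      rewrite /lam opprD addrACA subrr add0r -mulrBr -mulrBl.
      rewrite normrM (normrM _ _^-1) gtr0_norm ?subr_gt0// normfV normr_nat.
      have : `|L (u (e y)) - L (u (e z))| / N%:R <= N%:R^-1.
        by rewrite ler_pdivrMr// mulVf// gt_eqF.
      have : 0 <= `|L (u (e y)) - L (u (e z))| / N%:R by rewrite divr_ge0.
      by nra.
    have : `|lam (e y) - lam (e z)| * `|e z - s0| <= M / N%:R.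
      by rewrite mulrC ler_pM.
    by lra.
  right => x Cx; apply: h_id => Ux.
  by rewrite leNgt; apply/negP => ux; apply: far; exists x.
Qed.

(** * Collapsing a shrinkable set to a point *)

Lemma dependent_choice_seq (T : Type) (P : T -> Prop) (step : nat -> T -> T -> Prop) t0 :
  P t0 -> (forall n t, P t -> exists t', P t' /\ step n t t') ->
  exists f : nat -> T, [/\ f 0%N = t0, forall n, P (f n) &
    forall n, step n (f n) (f n.+1)].
Proof.
move=> Pt0 hstep.
have [g hg] : {g : nat * T -> T & forall nt, P nt.2 -> P (g nt) /\ step nt.1 nt.2 (g nt)}.
  apply: (@choice _ _ (fun (nt : nat * T) t' => P nt.2 -> P t' /\ step nt.1 nt.2 t')).
  move=> [n t]; have [/(hstep n) [t' ?]|nP] := pselect (P t); first by exists t'.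
  by exists t.
pose f := fix f n := if n is m.+1 then g (m, f m) else t0.
have Pf n : P (f n) by elim: n => //= n /(hg (n, f n)) [].
by exists f; split=> // n; have [] := hg (n, f n) (Pf n).
Qed.

Lemma harmonic_lt (R : realType) (e : R) : 0 < e -> exists n : nat, n.+1%:R^-1 < e.
Proof.
move=> e0; exists (Num.bound e^-1).
rewrite invf_plt ?posrE//; apply: lt_le_trans (archi_boundP _) _.
  by rewrite invr_ge0 ltW.
by rewrite ler_nat.
Qed.

Lemma support_stable (T : Type) (h : T -> T) (U : set T) :
  injective h -> (forall x, ~ U x -> h x = x) -> forall x, U x -> U (h x).
Proof.
move=> hinj hU x Ux; apply: contrapT => nU; apply: (nU).
by rewrite (hinj _ _ (hU _ nU)).
Qed.

Section Collapse.
Context {R : realType} {X : topologicalType} {d : X -> X -> R}.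
Hypothesis hd : compatible_metric d.
Hypothesis cX : compact [set: X].

Lemma small_thicken (f : X -> X) (K : set X) (e : R) : continuous f -> 0 < e ->
  small d (e / 3) (f @` K) -> exists2 r, 0 < r & small d e (f @` thicken d K r).
Proof.
move=> cf e0 fK; have e3 : 0 < e / 3 by rewrite divr_gt0.
have [r r0 hr] := cmetric_unif_continuous hd hd cX cf e3.
exists r => // _ _ [x [a Ka ax] <-] [y [b Kb bly] <-].
have := fK (f a) (f b) (ex_intro2 _ _ a Ka erefl) (ex_intro2 _ _ b Kb erefl).
have := hr _ _ ax; have := hr _ _ bly.
have := cmetric_tri hd (f a) (f x) (f y).
have := cmetric_tri hd (f b) (f a) (f y).
by rewrite (cmetric_sym hd (f x) (f a)); lra.
Qed.

Definition shrinkable (B : set X) := forall (U : set X) (e : R), open U ->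
  B `<=` U -> 0 < e -> exists h k : X -> X,
    [/\ homeomorphism h k, forall x, ~ U x -> h x = x & small d e (h @` B)].

(** Precompose [k] with a homeomorphism that shrinks [B] inside [U]. This changes
neither [k] off [U] nor the image of [U], hence alters the values of [k] by no more
than the diameter of that image, which the preceding step has made small. *)
Lemma shrink_step (B : set X) (k kinv : X -> X) (U : set X) (e : R) :
  shrinkable B -> homeomorphism k kinv -> open U -> B `<=` U -> 0 < e ->
  exists (k' k'inv : X -> X) (U' : set X),
    [/\ homeomorphism k' k'inv, open U' /\ B `<=` U', U' `<=` U /\ U' `<=` thicken d B e,
        (forall x, ~ U x -> k' x = k x) /\
        (forall x, U x -> exists2 y, U y & k' x = k y) &
        small d e (k' @` U')].
Proof.
move=> shB hk oU BU e0.
have e3 : 0 < e / 3 by rewrite divr_gt0.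
have [_ _ ck _] := hk.
have [eta eta0 heta] := cmetric_unif_continuous hd hd cX ck e3.
have [h [hinv [hh hid hB]]] := shB U eta oU BU eta0.
have hk' := homeomorphism_comp hh hk.
have [_ _ ck' _] := hk'.
have hhinj : injective h by case: hh => /can_inj.
have kB : small d (e / 3) ((k \o h) @` B).
  move=> _ _ [x Bx <-] [y By <-]; apply: heta.
  by apply: hB; [exists x|exists y].
have [r r0 hr] := small_thicken ck' e0 kB.
exists (k \o h), (hinv \o kinv), (U `&` thicken d B (Num.min r e)).
have re0 : 0 < Num.min r e by rewrite lt_min r0.
split=> //.
- split; first by apply: openI => //; exact: open_thicken.
  by move=> x Bx; split; [exact: BU|exact: (sub_thicken hd)].
- split=> x [Ux [b Bb bx]] //; exists b => //.
  by move: bx; rewrite lt_min => /andP[].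
- split=> x Ux; first by rewrite /= hid.
  by exists (h x) => //; exact: support_stable hid _ Ux.
- move=> _ _ [x [Ux [b Bb bx]] <-] [y [Uy [b' Bb' b'y]] <-].
  move: bx b'y; rewrite !lt_min => /andP[bx _] /andP[b'y _].
  by apply: hr; [exists x => //; exists b|exists y => //; exists b'].
Qed.

(** The limit of the homeomorphisms [h_1 \o ... \o h_n], where [h_n] shrinks [B]
inside a neighbourhood [U n] and the [U n] decrease to [B], is a model of the
quotient map onto [X / B] with target [X] itself: away from [B] the sequence
is eventually constant, while [B] goes to a single point. *)
Lemma collapse_to_self (B V : set X) : compact B -> shrinkable B ->
  open V -> B `<=` V -> exists p : X -> X,
    [/\ continuous p, forall y, exists x, p x = y,
        forall x y, p x = p y <-> x = y \/ (B x /\ B y),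
        forall x, ~ V x -> p x = x &
        forall (W : set X) (e : R), open W -> B `<=` W -> 0 < e ->
          exists k kinv : X -> X, [/\ homeomorphism k kinv,
            forall x, ~ W x -> k x = p x & forall x, d (k x) (p x) < e]].
Proof.
move=> cB shB oV BV.
pose eps (n : nat) : R := n.+1%:R^-1.
have eps0 n : 0 < eps n by rewrite invr_gt0 ltr0n.
have epslim e : 0 < e -> exists n, eps n < e by exact: harmonic_lt.
have epsle n m : (n <= m)%N -> eps m <= eps n.
  by move=> nm; rewrite lef_pV2 ?posrE ?ltr0n// ler_nat.
pose Inv (s : (X -> X) * set X) :=
  [/\ exists kinv, homeomorphism s.1 kinv, open s.2 & B `<=` s.2].
pose step (n : nat) (s s' : (X -> X) * set X) :=
  [/\ s'.2 `<=` s.2, s'.2 `<=` thicken d B (eps n),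
      forall x, ~ s.2 x -> s'.1 x = s.1 x,
      forall x, s.2 x -> exists2 y, s.2 y & s'.1 x = s.1 y &
      small d (eps n) (s'.1 @` s'.2)].
have [|n [k U] [[kinv hk] oU BU]|f [f0 finv fstep]] :=
    @dependent_choice_seq _ Inv step (id, V).
  by split=> //; exists id; exact: homeomorphism_id.
  have [k' [k'inv [U' [hk' [oU' BU'] [UU' U'B] [k'1 k'2] sm]]]] :=
    shrink_step shB hk oU BU (eps0 n).
  by exists (k', U'); split; split=> //; exists k'inv.
pose k n := (f n).1; pose U n := (f n).2.
have mono n m : (n <= m)%N -> [/\ U m `<=` U n,
    forall x, ~ U n x -> k m x = k n x &
    forall x, U n x -> exists2 y, U n y & k m x = k n y].
  elim: m => [|m IH]; first by rewrite leqn0 => /eqP->; split=> // x Ux; exists x.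
  rewrite leq_eqVlt => /predU1P[->|]; first by split=> // x Ux; exists x.
  rewrite ltnS => /IH [Umn km1 km2]; have [s1 s2 s3 s4 _] := fstep m.
  split; first by move=> x /s1 /Umn.
    by move=> x nU; rewrite -km1// /k s3// => /Umn.
  move=> x Ux; have [Umx|nUmx] := pselect (U m x).
    by have [y /Umn Uy ky] := s4 _ Umx; have [z Uz kz] := km2 _ Uy; exists z => //;
      rewrite /k ky.
  by have [y Uy ky] := km2 _ Ux; exists y => //; rewrite /k s3.
have smallU n : small d (eps n) (k n.+1 @` U n.+1) by have [] := fstep n.
have UB n : U n.+1 `<=` thicken d B (eps n) by have [] := fstep n.
have BU n : B `<=` U n by have [] := finv n.
have [kinv hk] : {kinv & forall n, homeomorphism (k n) (kinv n)}.
  by apply: (@choice _ _ (fun n => homeomorphism (k n))) => n; have [] := finv n.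
have cauchy n m x : (n <= m)%N -> d (k n.+1 x) (k m.+1 x) <= eps n.
  move=> nm; have [_ h1 h2] := @mono n.+1 m.+1 nm.
  have [Ux|/h1->] := pselect (U n.+1 x); last by rewrite (cmetric_refl hd) ltW.
  have [y Uy ->] := h2 _ Ux.
  by apply/ltW/smallU; [exists x|exists y].
have [p hp] := cmetric_limit hd cX epslim cauchy.
have cp : continuous p.
  have kc n : continuous (k n.+1) by case: (hk n.+1).
  exact: (@cmetric_limit_continuous R X X d (fun n => k n.+1) eps p hd epslim kc hp).
have psurj : forall y, exists x, p x = y.
  apply: (cmetric_limit_surjective hd cX epslim _ cp hp) => n y.
  by exists (kinv n.+1 y); case: (hk n.+1).
have poff n x : ~ U n x -> p x = k n x.
  move=> nU; apply/esym/(cmetric_eqP hd) => e e0.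
  have [m me] := epslim _ e0.
  have [_ /(_ _ nU) <- _] := @mono n (n + m).+1 (leqW (leq_addr _ _)).
  apply: le_lt_trans (hp _ _) _; apply: le_lt_trans me.
  by apply: epsle; rewrite leq_addl.
have pB a b : B a -> B b -> p a = p b.
  move=> Ba Bb; apply: (cmetric_eqP hd) => e e0.
  have e3 : 0 < e / 3 by rewrite divr_gt0.
  have [n ne] := epslim _ e3.
  have := hp n a; have := hp n b.
  have : d (k n.+1 a) (k n.+1 b) < eps n.
    by apply: smallU; [exists a => //; exact: BU|exists b => //; exact: BU].
  have := cmetric_tri hd (k n.+1 a) (p a) (p b).
  have := cmetric_tri hd (k n.+1 b) (k n.+1 a) (p b).
  by rewrite (cmetric_sym hd (p a) (k n.+1 a)); lra.
have pinj x y : ~ B x -> p x = p y -> x = y.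
  move=> nBx pxy.
  have oB : open (~` B) := closed_openC (cmetric_compact_closed hd cB).
  have [r r0 rB] := (cmetric_openP hd _).1 oB x nBx.
  have r2 : 0 < r / 2 by rewrite divr_gt0.
  have [n nr] := epslim _ r2.
  have ballU z : d x z < r / 2 -> ~ U n.+1 z.
    move=> xz /UB [b Bb bz]; apply: (rB b) => //.
    have := cmetric_tri hd z x b; rewrite (cmetric_sym hd z b); lra.
  have nUx : ~ U n.+1 x by apply: ballU; rewrite (cmetric_refl hd).
  have kinj : injective (k n.+1) by case: (hk n.+1) => /can_inj.
  have [Uy|nUy] := pselect (U n.+1 y); last first.
    by apply: kinj; rewrite -!poff.
  (* [k n.+1 x] is then a limit of points of the image of [U n.+1], which is
     impossible because [k n.+1] is a homeomorphism. *)
  have [kK _ _ ckinv] := hk n.+1.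
  have [s s0 hs] := (cmetric_continuousP hd hd _ _).1 (ckinv (k n.+1 x)) _ r2.
  have [m ms] := epslim _ s0.
  have [_ _ h2] := @mono n.+1 (n + m).+1 (leq_addr _ _); have [z Uz kz] := h2 y Uy.
  exfalso; apply: (ballU z) => //.
  have := hs (k n.+1 z); rewrite !kK; apply.
  rewrite -kz -(poff _ _ nUx) pxy (cmetric_sym hd).
  apply: le_lt_trans (hp _ _) _; apply: le_lt_trans ms.
  by apply: epsle; rewrite leq_addl.
exists p; split=> //.
- move=> x y; split=> [pxy|[->//|[Bx By]]]; last exact: pB.
  have [Bx|nBx] := pselect (B x); last by left; exact: pinj.
  have [By|nBy] := pselect (B y); first by right.
  by left; apply/esym/pinj.
- by move=> x nV; rewrite (poff 0%N) /U /k f0.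
- move=> W e oW BW e0.
  have [r r0 rW] := compact_open_thicken hd cB oW BW.
  have [|n] := epslim (Num.min e r); first by rewrite lt_min e0.
  rewrite lt_min => /andP[ne nr].
  exists (k n.+1), (kinv n.+1); split=> // x.
    move=> nW; rewrite -poff// => /UB [b Bb bx]; apply: nW.
    exact: rW Bb (lt_trans bx nr).
  exact: le_lt_trans (hp _ _) ne.
Qed.

End Collapse.

(** * Recursively starlike-equivalent sets *)

Lemma starlike_equivalent_homeo (R : realType) (Y X : topologicalType)
    (f : Y -> X) (g : X -> Y) (A : set Y) :
  homeomorphism f g -> starlike_equivalent R A -> starlike_equivalent R (f @` A).
Proof.
move=> [fg gf cf cg] [U [n [e [oU AU [einj ec eop] oeU sA]]]].
have im (D : set Y) : (e \o g) @` (g @^-1` D) = e @` D.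
  apply/seteqP; split=> v [x Dx <-]; first by exists (g x).
  by exists (f x); rewrite /= fg.
have fgE (D : set Y) : f @` D = g @^-1` D.
  apply/seteqP; split=> [_ [x Dx <-]|x Dx]; first by rewrite /= fg.
  by exists (g x).
have oU' : open (g @^-1` U) by apply: open_comp => // x _; exact: cg.
exists (g @^-1` U), n, (e \o g); split=> //.
- by move=> _ [x Ax <-] /=; rewrite fg; exact: AU.
- split.
  + move=> x y /[!inE] /= Ux Uy /einj; rewrite !inE => /(_ Ux Uy).
    exact: (can_inj gf).
  + rewrite continuous_open_subspace// => x /[!inE] Ux.
    apply: continuous_comp; first exact: cg.
    by move: ec; rewrite continuous_open_subspace// => /(_ (g x)); apply; rewrite inE.
  + move=> W oW.
    have oW' : open (f @^-1` W) by apply: open_comp => // x _; exact: cf.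
    have [V oV eV] := eop _ oW'; exists V => //.
    rewrite im -eV -im preimage_setI; congr (_ @` (_ `&` _)).
    by apply/seteqP; split=> x /=; rewrite gf.
- by rewrite im.
- by rewrite fgE im.
Qed.

Lemma collapse_map_eqP (X : topologicalType) (B : set X) x y :
  quotient_map (collapse B) x = quotient_map (collapse B) y <->
  x = y \/ (B x /\ B y).
Proof.
split=> [/eqquotP/asboolP h|[->//|[Bx By]]]; last first.
  apply/eqquotP/asboolP => A [->//|[z nBz <-]]; split=> /= zE; exfalso.
    by apply: nBz; rewrite -zE.
  by apply: nBz; rewrite -zE.
have [Bx|nBx] := pselect (B x).
  by right; split=> //; apply/(h B) => //; left.
by left; apply/esym; apply/(h [set x]) => //; right; exists x.
Qed.

(** Through this homeomorphism a hypothesis on the image of a set in [X / B] becomes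
one on its image under [p], inside [X] itself. *)
Lemma collapse_space_homeo (X : topologicalType) (B : set X) (p : X -> X) :
  compact [set: X] -> hausdorff_space X -> continuous p ->
  (forall y, exists x, p x = y) ->
  (forall x y, p x = p y <-> x = y \/ (B x /\ B y)) ->
  exists f g, homeomorphism f g /\
    forall x, f (quotient_map (collapse B) x) = p x.
Proof.
move=> cX hX cp psurj pB.
pose f : decomposition_space (collapse B) -> X := p \o repr.
have fE x : f (quotient_map (collapse B) x) = p x.
  by apply/pB/collapse_map_eqP; exact: reprK.
have cf : continuous f.
  apply: repr_comp_continuous => // x y /eqP xy; apply/eqP/pB.
  exact/collapse_map_eqP.
have cY : compact [set: decomposition_space (collapse B)].
  rewrite (_ : setT = quotient_map (collapse B) @` [set: X]).
    apply: continuous_compact => //; apply: continuous_subspaceT.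
    exact: pi_continuous.
  by apply/seteqP; split=> // y _; exists (repr y) => //; exact: reprK.
have finj : injective f.
  move=> a b; rewrite -[a]reprK -[b]reprK.
  by rewrite -/(quotient_map _ _) -/(quotient_map _ _) !fE => /pB/collapse_map_eqP.
have [g hg] : exists g, homeomorphism f g.
  apply: compact_bij_homeomorphism => // y; have [x <-] := psurj y.
  by exists (quotient_map _ x).
by exists f, g.
Qed.

Section Step.
Context {R : realType} {X : topologicalType} {d : X -> X -> R}.
Hypothesis hd : compatible_metric d.
Hypothesis cX : compact [set: X].

Lemma null_atS (A B : set X) H : B `<=` A -> null_at d A H -> null_at d B H.
Proof.
move=> BA nA e e0; have [W [oW AW hW]] := nA e e0; exists W; split=> //.
exact: subset_trans AW.
Qed.

Lemma null_shrinkable_shrinkable B : null_shrinkable d B -> shrinkable (d := d) B.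
Proof.
move=> nB U e oU BU e0.
have n0 : null_at d B set0 by move=> eps _; exists U; split.
by have [h [k [hk hU hB _]]] := nB set0 U e n0 oU BU e0; exists h, k.
Qed.

Lemma null_at_image (A B : set X) (p : X -> X) (H : set (set X)) :
  B `<=` A -> continuous p ->
  (forall x y, p x = p y <-> x = y \/ (B x /\ B y)) ->
  null_at d A H -> null_at d (p @` A) [set p @` C | C in H].
Proof.
move=> BA cp pB nA e e0.
have [s s0 hs] := cmetric_unif_continuous hd hd cX cp e0.
have [W [oW AW hW]] := nA s s0.
exists (~` (p @` (~` W))); split.
- apply: closed_openC; apply: (cmetric_compact_closed hd).
  apply: continuous_compact; first exact: continuous_subspaceT.
  exact: subclosed_compact (open_closedC oW) cX _.
- move=> _ [a Aa <-] /= -[x nWx /pB xa]; apply: nWx; apply: AW.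
  by case: xa => [->//|[Bx _]]; exact: BA.
- move=> _ [C HC <-] [_ [[c Cc <-] nW]].
  have Wc : W c by apply: contrapT => nWc; apply: nW; exists c.
  have sC : small d s C by apply: hW => //; exists c.
  by move=> _ _ [x Cx <-] [y Cy <-]; apply/hs/sC.
Qed.

(** First shrink [B] by [h1], so that collapsing the small set [h1 @` B] to a point
moves points only slightly. In the resulting copy [p1] of [X -> X / B] the image of
[A] is starlike-equivalent, and is shrunk by some [h']. Only then is a
homeomorphism [k] chosen, so close to [p1] that [h' \o k] still
shrinks [A], while agreeing with [p1] on all members of the family
that are not tiny. *)
Lemma null_shrinkable_extend (A B : set X) :
  B `<=` A -> compact B -> null_shrinkable d B ->
  starlike_equivalent R (quotient_map (collapse B) @` A) ->
  null_shrinkable d A.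
Proof.
move=> BA cB nB sAB H U e nA oU AU e0.
have nBH := null_atS BA nA.
have BU := subset_trans BA AU.
have e3 : 0 < e / 3 by rewrite divr_gt0.
have e9 : 0 < e / 3 / 3 by rewrite divr_gt0.
(* [small_thicken] loses a factor [3], whence the ninth of [e]. *)
have [h1 [h1inv [hh1 h1U h1B h1C]]] := nB H U _ nBH oU BU e9.
have [_ _ ch1 _] := hh1.
have h1inj : injective h1 by case: hh1 => /can_inj.
have [r r0 hr] := small_thicken hd cX ch1 e3 h1B.
have [eta eta0 heta] := cmetric_unif_continuous hd hd cX ch1 e3.
have [W1 [oW1 BW1 hW1]] := nBH _ eta0.
pose V := U `&` (thicken d B r `&` W1).
have oV : open V by apply: openI => //; apply: openI => //; exact: open_thicken.
have BV : B `<=` V.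
  by move=> x Bx; split; [exact: BU|split; [exact: (sub_thicken hd)|exact: BW1]].
have shB := null_shrinkable_shrinkable nB.
have [p [cp psurj pB pV papprox]] := collapse_to_self hd cX cB shB oV BV.
have pstable x : V x -> V (p x).
  move=> Vx; apply: contrapT => nV; have /pB[px|[Bpx _]] := pV _ nV.
    by apply: nV; rewrite px.
  by apply: nV; exact: BV.
have h1p x : d (h1 (p x)) (h1 x) < e / 3.
  have [Vx|/pV->] := pselect (V x); last by rewrite (cmetric_refl hd).
  by apply: hr; [exists (p x) => //; case: (pstable _ Vx) => _ []|exists x => //; case: Vx => _ []].
pose p1 := h1 \o p.
have cp1 : continuous p1 by move=> x; apply: continuous_comp; [exact: cp|exact: ch1].
have p1surj y : exists x, p1 x = y.
  have [x px] := psurj (h1inv y); exists x.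
  by rewrite /p1 /= px; case: hh1.
have p1B x y : p1 x = p1 y <-> x = y \/ (B x /\ B y).
  by split=> [/h1inj/pB//|/pB xy]; rewrite /p1 /= xy.
have p1U x : ~ U x -> p1 x = x.
  by move=> nU; rewrite /p1 /= pV ?h1U// => -[].
have p1C C : H C -> small d e (p1 @` C) \/ forall x, C x -> p1 x = x.
  move=> HC; have [CV|nCV] := pselect (C `&` V !=set0).
    have sC : small d eta C.
      by apply: hW1 => //; case: CV => x [Cx [_ [_ Wx]]]; exists x.
    left=> _ _ [x Cx <-] [y Cy <-]; rewrite /p1 /=.
    have := heta _ _ (sC _ _ Cx Cy).
    have := h1p x; have := h1p y; rewrite (cmetric_sym hd (h1 (p y))).
    have := cmetric_tri hd (h1 x) (h1 (p x)) (h1 (p y)).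
    have := cmetric_tri hd (h1 y) (h1 x) (h1 (p y)).
    by lra.
  have pid x : C x -> p x = x by move=> Cx; apply: pV => Vx; apply: nCV; exists x.
  have [sC|idC] := h1C _ HC; [left|right].
    move=> _ _ [x Cx <-] [y Cy <-]; rewrite /p1 /= !pid//.
    have : d (h1 x) (h1 y) < e / 3 / 3 by apply: sC; [exists x|exists y].
    lra.
  by move=> x Cx; rewrite /p1 /= pid// idC.
have [f [g [fg fE]]] :=
  collapse_space_homeo cX (cmetric_hausdorff hd) cp1 p1surj p1B.
have sA1 : starlike_equivalent R (p1 @` A).
  rewrite (_ : p1 @` A = f @` (quotient_map (collapse B) @` A)).
    exact: starlike_equivalent_homeo fg sAB.
  by rewrite image_comp; apply: eq_imagel => x _; apply/esym/fE.
have A1U : p1 @` A `<=` U.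
  move=> _ [a Aa <-]; apply: contrapT => nU.
  have /p1B[pa|[Ba _]] := p1U _ nU; apply: nU; last exact: BU.
  by rewrite pa; exact: AU.
have [h' [h'inv [hh' h'U h'A h'C]]] :=
  starlike_null_shrinkable hd cX sA1 (null_at_image BA cp1 p1B nA) oU A1U e3.
have [_ _ ch' _] := hh'.
have [z z0 hz] := cmetric_unif_continuous hd hd cX ch' e3.
have z3 : 0 < z / 3 by rewrite divr_gt0.
have [s s0 hs] := cmetric_unif_continuous hd hd cX cp1 z3.
have [W2 [oW2 BW2 hW2]] := nBH _ s0.
have [t t0 ht] := cmetric_unif_continuous hd hd cX ch1 z3.
have BW2V : B `<=` W2 `&` V by move=> x Bx; split; [exact: BW2|exact: BV].
have [k0 [k0inv [hk0 k0p k0near]]] := papprox _ t (openI oW2 oV) BW2V t0.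
pose k := h1 \o k0.
have hk : homeomorphism k (k0inv \o h1inv) := homeomorphism_comp hk0 hh1.
have knear x : d (k x) (p1 x) < z / 3 by apply: ht; exact: k0near.
have kp x : ~ (W2 `&` V) x -> k x = p1 x by move=> nW; rewrite /k /= k0p.
have h'k x : d (h' (k x)) (h' (p1 x)) < e / 3.
  by apply: hz; have := knear x; lra.
exists (h' \o k), ((k0inv \o h1inv) \o h'inv); split.
- exact: homeomorphism_comp hk hh'.
- by move=> x nU; rewrite /= kp ?p1U ?h'U// => -[_ []].
- move=> _ _ [x Ax <-] [y Ay <-] /=.
  have := h'k x; have := h'k y; rewrite (cmetric_sym hd (h' (k y))).
  have : d (h' (p1 x)) (h' (p1 y)) < e / 3.
    by apply: h'A; [exists (p1 x) => //; exists x|exists (p1 y) => //; exists y].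
  have := cmetric_tri hd (h' (p1 x)) (h' (k x)) (h' (k y)).
  have := cmetric_tri hd (h' (p1 y)) (h' (p1 x)) (h' (k y)).
  by lra.
move=> C HC.
have [CW|nCW] := pselect (C `&` (W2 `&` V) !=set0).
  have sC : small d s C.
    by apply: hW2 => //; case: CW => x [Cx [Wx _]]; exists x.
  left=> _ _ [x Cx <-] [y Cy <-] /=.
  suff : d (k x) (k y) < z by move=> /hz; lra.
  have := hs _ _ (sC _ _ Cx Cy).
  have := knear x; have := knear y; rewrite (cmetric_sym hd (k y)).
  have := cmetric_tri hd (p1 x) (k x) (k y).
  have := cmetric_tri hd (p1 y) (p1 x) (k y).
  by lra.
have kC x : C x -> k x = p1 x by move=> Cx; apply: kp => Wx; apply: nCW; exists x.
have [sC|idC] := h'C _ (ex_intro2 _ _ C HC erefl).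
  left=> _ _ [x Cx <-] [y Cy <-] /=; rewrite !kC//.
  have : d (h' (p1 x)) (h' (p1 y)) < e / 3.
    by apply: sC; [exists (p1 x) => //; exists x|exists (p1 y) => //; exists y].
  by lra.
have hC x : C x -> (h' \o k) x = p1 x by move=> Cx; rewrite /= kC// idC//; exists x.
have [sC|id1] := p1C _ HC; [left|right].
  by move=> _ _ [x Cx <-] [y Cy <-]; rewrite !hC//; apply: sC; [exists x|exists y].
by move=> x Cx; rewrite hC// id1.
Qed.

Lemma recursively_starlike_null_shrinkable (A : set X) :
  recursively_starlike_equivalent R A -> null_shrinkable d A.
Proof.
move=> [m]; elim: m A => [|m IH] A.
  by move=> /starlike_filtration0; exact: starlike_null_shrinkable.
move=> [F [cF F0 Fi <-]].
have [FS sF] := Fi m (ltnSn m).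
apply: (null_shrinkable_extend FS) => //; first exact: cF.
apply: IH; exists F; split=> // i im; first exact/cF/leqW.
exact/Fi/ltnW.
Qed.

End Step.

(** * Shrinking a null decomposition *)

Lemma seq_common_radius (R : realType) (T : eqType) (P : T -> R -> Prop) (s : seq T) :
  (forall t r r', P t r -> 0 < r' <= r -> P t r') ->
  (forall t, t \in s -> exists2 r, 0 < r & P t r) ->
  exists2 r, 0 < r & forall t, t \in s -> P t r.
Proof.
move=> Pmono; elim: s => [_|t s IH h]; first by exists 1.
have [r r0 hr] : exists2 r, 0 < r & forall t, t \in s -> P t r.
  by apply: IH => u us; apply: h; rewrite inE us orbT.
have [r1 r10 hr1] := h t (mem_head _ _).
exists (Num.min r r1); first by rewrite lt_min r0.
have m0 : 0 < Num.min r r1 by rewrite lt_min r0.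
move=> u; rewrite inE => /predU1P[->|us].
  by apply: Pmono hr1 _; rewrite m0 ge_min lexx orbT.
by apply: Pmono (hr u us) _; rewrite m0 ge_min lexx.
Qed.

Section Diam.
Context {R : realType} {T : Type} (d : T -> T -> R).

Lemma small_diam (e : R) C : small d e C -> (diam d C <= e%:E)%E.
Proof.
move=> sC; apply: ge_ereal_sup => _ [x Cx [y Cy <-]].
by rewrite lee_fin ltW// sC.
Qed.

Lemma diam_small (e : R) C : ~ (e%:E <= diam d C)%E -> small d e C.
Proof.
move=> /negP; rewrite -ltNge => dC x y Cx Cy.
rewrite -lte_fin; apply: le_lt_trans dC; apply: ereal_sup_ubound.
by exists x => //; exists y.
Qed.

End Diam.

Section NullDecomposition.
Context {R : realType} {X : topologicalType} {d : X -> X -> R}.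
Hypothesis hd : compatible_metric d.
Variable G : set (set X).
Hypothesis partG : partition G id [set: X].
Hypothesis compG : forall A, G A -> compact A.
Hypothesis nullG : null_collection d G.

Lemma null_collection_null_at A : G A -> null_at d A (G `\` [set A]).
Proof.
move=> GA e e0; have := nullG e0; set L := [set B | _] => finL.
exists (~` \bigcup_(B in L `\` [set A]) B); split.
- apply: closed_openC; apply: closed_bigcup; first exact: finite_setD.
  by move=> B [[GB _] _]; apply: (cmetric_compact_closed hd); exact: compG.
- move=> x Ax [B [[GB _] nBA] Bx]; apply: nBA => /=.
  by case: partG => _ triv _; apply: triv => //; exists x.
move=> C [GC nCA] [x [Cx nx]]; apply: diam_small => dC.
by apply: nx; exists C.
Qed.

(** Only finitely many members are large. They are shrunk one after
the other inside disjoint saturated neighbourhoods, the preimages of small balls,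
so that each member is affected by at most one of these shrinkings. *)
Lemma null_strong_shrinking
    (sigma : decomposition_space G -> decomposition_space G -> R) :
  (forall A, G A -> ~ (exists x, A = [set x]) -> null_shrinkable d A) ->
  compatible_metric sigma ->
  strong_shrinking_criterion d sigma (quotient_map G).
Proof.
move=> nsG hs del C del0 cC injC.
pose p := quotient_map G.
have pE x y : p x = p y <-> exists A, [/\ G A, A x & A y] := quotient_map_eqP partG x y.
have cp : continuous p by exact: pi_continuous.
have [covG trivG neG] := partG.
have Gx x : exists2 A, G A & A x.
  have : cover G id x by rewrite covG.
  by move=> [A GA Ax]; exists A.
have pA A a b : G A -> A a -> A b -> p a = p b.
  by move=> GA Aa Ab; apply/pE; exists A.
have Ap A a b : G A -> A a -> p a = p b -> A b.
  move=> GA Aa /pE [B [GB Ba Bb]].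
  by rewrite (trivG A B)//; exists a.
have del2 : 0 < del / 2 by rewrite divr_gt0.
have [s sE] := (finite_seqP _).1 (nullG del2).
have sP A : A \in s -> G A /\ ((del / 2)%:E <= diam d A)%E.
  by move=> As; have : [set` s] A by []; rewrite -sE.
have nsP A : G A -> A \notin s -> small d (del / 2) A.
  move=> GA nAs; apply: diam_small => dA; move/negP: nAs; apply.
  by suff : [set` s] A by []; rewrite -sE.
have ns1 A : A \in s -> ~ exists x, A = [set x].
  move=> As [x Ax]; have [_] := sP A As; apply/negP; rewrite -ltNge.
  have s4 : 0 < del / 4 by rewrite divr_gt0.
  apply: le_lt_trans (_ : (del / 4)%:E < _)%E; last by rewrite lte_fin; lra.
  by apply: small_diam; rewrite Ax => _ _ -> ->; rewrite (cmetric_refl hd).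
(* A ball of radius [r] about the image of [A] misses [C] and the balls of radius [r]
   about the images of the other large members. *)
pose P A (r : R) := (forall a y, A a -> C y -> r <= sigma (p a) y) /\
  forall B, B \in s -> B <> A -> forall a b, A a -> B b -> 2 * r <= sigma (p a) (p b).
have [r r0 [rdel rP]] : exists2 r : R, 0 < r &
    r <= del / 4 /\ forall A, A \in s -> P A r.
  have [||r r0 hr] := @seq_common_radius R _ P s.
  - move=> A r r' [h1 h2] /andP[r'0 r'r]; split=> [a y Aa Cy|B Bs BA a b Aa Bb].
      exact: le_trans r'r (h1 _ _ Aa Cy).
    by have := h2 B Bs BA a b Aa Bb; lra.
  - move=> A As; have [GA _] := sP A As; have [a0 Aa0] := neG A GA.
    have nC : ~ C (p a0).
      move=> Ca0; apply: (ns1 A As); exists a0; apply/seteqP; split=> [b Ab|_ ->//].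
      have pba : p b = p a0 := pA _ _ _ GA Ab Aa0.
      apply: injC; [rewrite inE|rewrite inE; exact: Ca0|exact: pba].
      by rewrite /preimage /= -/(p b) pba.
    have [r1 r10 hr1] := (cmetric_openP hs _).1 (closed_openC cC) _ nC.
    have [||r2 r20 hr2] := @seq_common_radius R _
        (fun B r => B <> A -> forall b, B b -> 2 * r <= sigma (p a0) (p b)) s.
    + by move=> B r r' h /andP[r'0 r'r] BA b Bb; have := h BA b Bb; lra.
    + move=> B Bs; have [GB _] := sP B Bs; have [b0 Bb0] := neG B GB.
      have [BA|nBA] := pselect (B = A); first by exists 1.
      have ab : p a0 <> p b0.
        by move=> /(Ap _ _ _ GA Aa0) Ab0; apply: nBA; apply: trivG => //; exists b0.
      exists (sigma (p a0) (p b0) / 2); first by rewrite divr_gt0// (cmetric_gt0 hs).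
      move=> _ b Bb; rewrite (pA B b b0)//; lra.
    exists (Num.min r1 r2); first by rewrite lt_min r10.
    split=> [a y Aa Cy|B Bs BA a b Aa Bb]; rewrite (pA A a a0)//.
      rewrite ge_min; apply/orP; left; rewrite leNgt; apply/negP => h.
      exact: hr1 h Cy.
    apply: le_trans (hr2 B Bs BA b Bb).
    by rewrite ler_pM2l// ge_min lexx orbT.
  exists (Num.min r (del / 4)); first by rewrite lt_min r0 divr_gt0.
  split; first by rewrite ge_min lexx orbT.
  move=> A As; have [h1 h2] := hr A As.
  have hm : Num.min r (del / 4) <= r by rewrite ge_min lexx.
  split=> [a y Aa Cy|B Bs BA a b Aa Bb].
    exact: le_trans hm (h1 _ _ Aa Cy).
  by have := h2 B Bs BA a b Aa Bb; lra.
pose V A := [set x | exists2 a, A a & sigma (p a) (p x) < r].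
have oV A : open (V A).
  rewrite openE => x [a Aa ax].
  have : nbhs x (p @^-1` [set y | sigma (p a) y < r]).
    exact: (cp x _ (open_nbhs_nbhs (conj (cmetric_open_ball hs (p a) r) ax))).
  by apply: filterS => y ay; exists a.
have AV A : A `<=` V A by move=> a Aa; exists a => //; rewrite (cmetric_refl hs).
have disjV A B x : A \in s -> B \in s -> V A x -> V B x -> A = B.
  move=> As Bs [a Aa ax] [b Bb bx]; apply: contrapT => AB.
  have BA : B <> A by move=> BA; exact/AB/esym.
  have [_ /(_ B Bs BA a b Aa Bb)] := rP A As.
  by have := cmetric_tri hs (p x) (p a) (p b); rewrite (cmetric_sym hs (p x)); lra.
have satV A B x y : G B -> B x -> B y -> V A x -> V A y.
  by move=> GB Bx By [a Aa ax]; exists a => //; rewrite (pA B y x).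
have [h [k [hk h1 h2 h3]]] : exists h k : X -> X, [/\ homeomorphism h k,
    forall x, h x = x \/ exists A, [/\ A \in s, V A x & V A (h x)],
    forall A, A \in s -> small d (del / 2) (h @` A) &
    forall A, G A -> A \notin s -> small d (del / 2) (h @` A)].
  suff main t : {subset t <= s} -> uniq t -> exists h k : X -> X, [/\ homeomorphism h k,
      forall x, h x = x \/ exists A, [/\ A \in t, V A x & V A (h x)],
      forall A, A \in t -> small d (del / 2) (h @` A) &
      forall A, G A -> A \notin s -> small d (del / 2) (h @` A)].
    have [|h [k [hk h1 h2 h3]]] := main (undup s) _ (undup_uniq s).
      by move=> A; rewrite mem_undup.
    exists h, k; split=> //.
      move=> x; have [|[A [As V1 V2]]] := h1 x; [by left|right].
      by exists A; rewrite -mem_undup.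
    by move=> A As; apply: h2; rewrite mem_undup.
  elim: t => [_ _|A t IH ts /= /andP[nAt ut]].
    exists id, id; split=> //; first exact: homeomorphism_id.
      by left.
    by move=> A GA nAs; rewrite image_id; exact: nsP.
  have [|//|h [k [hk h1 h2 h3]]] := IH.
    by move=> B Bt; apply: ts; rewrite inE Bt orbT.
  have As : A \in s by apply: ts; exact: mem_head.
  have ts' B : B \in t -> B \in s by move=> Bt; apply: ts; rewrite inE Bt orbT.
  have [GA _] := sP A As.
  have [g [ginv [hg gV gA gC]]] := nsG A GA (ns1 A As) _ (V A) (del / 2)
    (null_collection_null_at GA) (oV A) (@AV A) del2.
  have ginj : injective g by case: hg => /can_inj.
  have h_in x : V A x -> h x = x.
    move=> Vx; have [//|[B [Bt VBx _]]] := h1 x.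
    by move: nAt; rewrite (disjV A B x)// ?Bt// ts'.
  have g_out x : ~ V A x -> g (h x) = h x.
    move=> nVx; apply: gV => VAhx; have [hx|[B [Bt VBx VBhx]]] := h1 x.
      by apply: nVx; rewrite -hx.
    by apply: nVx; rewrite (disjV A B (h x))// ts'.
  exists (g \o h), (k \o ginv); split.
  - exact: homeomorphism_comp hk hg.
  - move=> x /=; have [Vx|nVx] := pselect (V A x).
      right; exists A; split=> //; first exact: mem_head.
      by rewrite h_in//; exact: support_stable ginj gV _ Vx.
    rewrite g_out//; have [|[B [Bt V1 V2]]] := h1 x; [by left|right].
    by exists B; split=> //; rewrite inE Bt orbT.
  - move=> B; rewrite inE => /predU1P[->|Bt].
      move=> _ _ [x Ax <-] [y Ay <-] /=; rewrite !h_in; [|exact: AV..].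
      by apply: gA; [exists x|exists y].
    have nV x : B x -> ~ V A x.
      move=> Bx VAx; move: nAt; rewrite (disjV A B x)// ?Bt// ?ts'//.
      exact: AV.
    move=> _ _ [x Bx <-] [y By <-] /=; rewrite !g_out; [|exact: nV..].
    by apply: (h2 B Bt); [exists x|exists y].
  - move=> B GB nBs.
    have [[x [Bx Vx]]|nBV] := pselect (exists x, B x /\ V A x); last first.
      move=> _ _ [x Bx <-] [y By <-] /=; rewrite !g_out.
      + by apply: (h3 B GB nBs); [exists x|exists y].
      + by move=> Vy; apply: nBV; exists y.
      + by move=> Vx; apply: nBV; exists x.
    have hB y : B y -> h y = y by move=> By; apply/h_in/(satV A B x).
    have BA : (G `\` [set A]) B by split=> // BA; move: nBs; rewrite BA As.
    have [sB|idB] := gC B BA => _ _ [y By <-] [z Bz <-] /=; rewrite !hB//.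
      by apply: sB; [exists y|exists z].
    by rewrite !idB//; exact: nsP GB nBs _ _ By Bz.
exists h, k; split=> //.
- move=> y; have [x xy] : exists x, p x = y by exists (repr y); exact: reprK.
  have [A GA Ax] := Gx x.
  have sA : small d (del / 2) (h @` A).
    by have [/h2//|/(h3 A GA)] := boolP (A \in s).
  apply: (@le_lt_trans _ _ (del / 2)%:E); last by rewrite lte_fin; lra.
  apply: small_diam => _ _ [u /= uy <-] [v /= vy <-].
  by apply: sA; [exists u|exists v] => //; apply: (Ap A x) => //; rewrite xy.
- apply: (@le_lt_trans _ _ (del / 2)%:E); last by rewrite lte_fin; lra.
  apply: ge_ereal_sup => _ [x _ <-]; rewrite lee_fin /=.
  have hkx : h (k x) = x by case: hk.
  have [hx|[A [As [a Aa ax] [b Ab bx]]]] := h1 (k x).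
    by rewrite -/(p _) -[in p x]hkx hx (cmetric_refl hs) ltW.
  rewrite hkx in bx; have [GA _] := sP A As.
  rewrite (pA A b a)// in bx.
  suff : sigma (p x) (p (k x)) <= del / 2 by [].
  have := cmetric_tri hs (p a) (p x) (p (k x)).
  by rewrite (cmetric_sym hs (p x) (p a)); lra.
- move=> x Cx; have [//|[A [As [a Aa ax] _]]] := h1 x.
  by have [+ _] := rP A As => /(_ a (p x) Aa Cx); rewrite leNgt ax.
Qed.

End NullDecomposition.

(** * From shrinking to approximation by homeomorphisms *)

Section Bing.
Context {R : realType} {X Y : topologicalType}.
Context {d : X -> X -> R} {sigma : Y -> Y -> R}.
Hypothesis hd : compatible_metric d.
Hypothesis hs : compatible_metric sigma.
Hypothesis cX : compact [set: X].

(** The pairs of points at distance at least [e] form a compact subset of [X * X], on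
which the distance of the images does not vanish. *)
Lemma fibre_modulus (f : X -> Y) (e : R) : continuous f -> 0 < e ->
  (forall x y, f x = f y -> d x y < e) ->
  exists2 r : R, 0 < r & forall x y, sigma (f x) (f y) < r -> d x y < e.
Proof.
move=> cf e0 hf.
have cXX : compact [set: X * X] by rewrite -setXTT; exact: compact_setX.
move/compact_near_coveringP: cXX => cXX.
pose P (i : R) (z : X * X) := sigma (f z.1) (f z.2) < i -> d z.1 z.2 < e.
have near_r : \forall i \near 0^'+, [set: X * X] `<=` P i.
  apply: cXX => -[x y] _.
  have [fxy|fxy] := pselect (f x = f y).
    have dxy := hf _ _ fxy; pose c := (e - d x y) / 2.
    have c0 : 0 < c by rewrite divr_gt0// subr_gt0.
    exists ([set z : X * X | d x z.1 < c /\ d y z.2 < c], setT) => /=.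
      split; last exact: filterT.
      exists ([set u | d x u < c], [set u | d y u < c]) => //.
      by split; exact: cmetric_nbhs_ball.
    move=> [[u v] i] /= [[xu yv] _] _ /=.
    have := cmetric_tri hd x u v; have := cmetric_tri hd y x v.
    by rewrite (cmetric_sym hd u x) /c in xu yv *; lra.
  pose c := sigma (f x) (f y) / 3.
  have c0 : 0 < c by rewrite divr_gt0// (cmetric_gt0 hs).
  have nc u : nbhs u [set v | sigma (f u) (f v) < c].
    exact: (cf u _ (cmetric_nbhs_ball hs _ c0)).
  exists ([set z : X * X | sigma (f x) (f z.1) < c /\ sigma (f y) (f z.2) < c],
          [set i | i < c]) => /=.
    split; last exact: nbhs_right_lt.
    by exists ([set u | sigma (f x) (f u) < c], [set u | sigma (f y) (f u) < c]).
  move=> [[u v] i] /= [[xu yv] ic] /= uv; exfalso.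
  have := cmetric_tri hs (f u) (f x) (f y); have := cmetric_tri hs (f v) (f u) (f y).
  by rewrite (cmetric_sym hs (f v) (f y)) /c in xu yv ic *; lra.
have [r [hr r0]] : exists r : R, [set: X * X] `<=` P r /\ 0 < r.
  apply: (@filter_ex _ (0 : R)^'+).
  by apply: filterI near_r _; exact: nbhs_right_gt.
by exists r => // x y; exact: (hr (x, y) I).
Qed.

(** Bing's argument: composing [p] with inverses of shrinking homeomorphisms, each
chosen after the previous one, gives a Cauchy sequence of maps whose fibres
become arbitrarily small. If the total change still to come is always smaller than the
error tolerated by the fibres reached so far, then the limit is injective. *)
Lemma strong_shrinking_near_homeomorphism (p : X -> Y) :
  compact [set: Y] -> continuous p -> (forall y, exists x, p x = y) ->
  strong_shrinking_criterion d sigma p -> strong_near_homeomorphism sigma p.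
Proof.
move=> cY cp psurj ssc eps C eps0 cC injC.
pose ep (n : nat) : R := n.+1%:R^-1.
have ep0 n : 0 < ep n by rewrite invr_gt0 ltr0n.
have eplim e : 0 < e -> exists n, ep n < e by exact: harmonic_lt.
(* In a pair [(H, r)], the number [r] bounds the total of all later changes to
   [p \o H]; after the first step it is also at most half of the error that the
   fibres of [p \o H] tolerate. *)
pose Inv (s : (X -> X) * R) := [/\ exists Hinv, homeomorphism s.1 Hinv, 0 < s.2 &
  forall x, C (p x) -> s.1 x = x].
pose step n (s s' : (X -> X) * R) := [/\ s'.2 <= s.2 / 2, s'.2 < ep n,
  forall x, sigma (p (s.1 x)) (p (s'.1 x)) <= s.2 / 2 &
  forall x y, sigma (p (s'.1 x)) (p (s'.1 y)) <= 2 * s'.2 -> d x y < ep n].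
have [|n [H r] [[Hinv hH] r0 HC]|f [f0 finv fstep]] :=
    @dependent_choice_seq _ Inv step (id, eps / 2).
- by split=> //=; [exists id; exact: homeomorphism_id|rewrite divr_gt0].
- rewrite /= in hH r0 HC.
  have [HK _ cH cHinv] := hH.
  have [eta eta0 heta] := cmetric_unif_continuous hd hd cX cHinv (ep0 n).
  have del0 : 0 < Num.min eta (r / 2) by rewrite lt_min eta0 divr_gt0.
  have [h [k [hk h1 h2 h3]]] := ssc _ C del0 cC injC.
  have [hK kK ch ck] := hk.
  have hkH := homeomorphism_comp hH (homeomorphism_sym hk).
  have [_ _ ckH _] := hkH.
  have cpkH : continuous (p \o (k \o H)).
    by move=> x; apply: continuous_comp; [exact: ckH|exact: cp].
  have fibre x y : (p \o (k \o H)) x = (p \o (k \o H)) y -> d x y < ep n.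
    move=> /= pxy; rewrite -[x]HK -[y]HK; apply: heta.
    rewrite -lte_fin; apply: (@lt_le_trans _ _ (Num.min eta (r / 2))%:E); last first.
      by rewrite lee_fin ge_min lexx.
    apply: le_lt_trans (h1 (p (k (H y)))); apply: ereal_sup_ubound.
    exists (H x); first by exists (k (H x)).
    by exists (H y) => //; exists (k (H y)).
  have [r' r'0 hr'] := fibre_modulus cpkH (ep0 n) fibre.
  pose r2 := Num.min (r / 2) (Num.min (ep n / 2) (r' / 4)).
  have r2r : r2 <= r / 2 by rewrite ge_min lexx.
  have r2e : r2 <= ep n / 2 by rewrite !ge_min lexx !orbT.
  have r2r' : r2 <= r' / 4 by rewrite !ge_min lexx !orbT.
  have r20 : 0 < r2 by rewrite !lt_min !divr_gt0.
  exists (k \o H, r2); split; split=> //=.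
  + by exists (Hinv \o h).
  + by move=> x Cx; rewrite HC// -[in LHS](h3 x Cx) hK.
  + by have := ep0 n; lra.
  + move=> x; apply/ltW; rewrite -lte_fin.
    apply: (@lt_le_trans _ _ (Num.min eta (r / 2))%:E); last first.
      by rewrite lee_fin ge_min lexx orbT.
    by apply: le_lt_trans h2; apply: ereal_sup_ubound; exists (H x).
  + by move=> x y xy; apply: hr' => /=; lra.
pose H n := (f n).1; pose r n := (f n).2.
have r0 n : 0 < r n by have [] := finv n.
have rlim e : 0 < e -> exists n, r n < e.
  move=> /eplim [n ne]; exists n.+1; have [_ h _ _] := fstep n.
  exact: lt_trans h ne.
have cauchy' n m x : (n <= m)%N ->
    sigma (p (H n x)) (p (H m x)) <= r n - r m.
  elim: m => [|m IH]; first by rewrite leqn0 => /eqP->; rewrite subrr (cmetric_refl hs).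
  rewrite leq_eqVlt => /predU1P[->|]; first by rewrite subrr (cmetric_refl hs).
  rewrite ltnS => /IH {}IH; have [h1 _ h2 _] := fstep m.
  have := cmetric_tri hs (p (H m x)) (p (H n x)) (p (H m.+1 x)).
  by have := h2 x; rewrite /r /H in h1 IH *; lra.
have cauchy n m x : (n <= m)%N -> sigma ((p \o H n) x) ((p \o H m) x) <= r n.
  by move=> /(cauchy' n m x) /=; have := r0 m; lra.
have [q hq] := cmetric_limit hs cY rlim cauchy.
have cpH n : continuous (p \o H n).
  move=> x; apply: continuous_comp; last exact: cp.
  by have [[Hinv [_ _ cH _]] _ _] := finv n; exact: cH.
have cq : continuous q := cmetric_limit_continuous hs rlim cpH hq.
have qsurj : forall y, exists x, q x = y.
  apply: (cmetric_limit_surjective hs cX rlim _ cq hq) => n y.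
  have [[Hinv [_ HinvK _ _]] _ _] := finv n; have [x px] := psurj y.
  by exists (Hinv x); rewrite /H /= HinvK.
have qinj : injective q.
  move=> x y qxy; apply: (cmetric_eqP hd) => e /eplim [n ne].
  apply: lt_trans ne; have [_ _ _] := fstep n; apply.
  have := hq n.+1 x; have := hq n.+1 y; rewrite -qxy.
  have := cmetric_tri hs (q x) (p (H n.+1 x)) (p (H n.+1 y)).
  by rewrite (cmetric_sym hs (q x)) /H /r /=; lra.
have [g hg] := compact_bij_homeomorphism cX (cmetric_hausdorff hs) cq qinj qsurj.
exists q, g; split=> //.
- apply: (@le_lt_trans _ _ (eps / 2)%:E); last by rewrite lte_fin; lra.
  apply: ge_ereal_sup => _ [x _ <-]; rewrite lee_fin.
  by have := hq 0%N x; rewrite /H /r f0.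
- move=> x Cx; apply/esym/(cmetric_eqP hs) => e /rlim [n ne].
  have := hq n x; have [_ _ HC] := finv n.
  by rewrite /= /H HC// => h; exact: le_lt_trans h ne.
Qed.

End Bing.

Theorem corollary2 (R : realType) (X : metricType R) (G : set (set X)) :
  compact [set: X] ->
  decomposition G ->
  null_collection (@mdist R X) G ->
  (forall A, G A -> ~ (exists x, A = [set x]) ->
    recursively_starlike_equivalent R A) ->
  strongly_shrinkable G /\
  (forall sigma : decomposition_space G -> decomposition_space G -> R,
    compatible_metric sigma ->
    strong_near_homeomorphism sigma (quotient_map G)).
Proof.
move=> cX [partG compG _] nullG recG.
have hd := mdist_compatible X.
have ss : strongly_shrinkable G.
  move=> sigma hs; apply: null_strong_shrinking => // A GA /(recG A GA).
  exact: recursively_starlike_null_shrinkable.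
split=> // sigma hs.
have surj y : exists x, quotient_map G x = y by exists (repr y); exact: reprK.
have cp : continuous (quotient_map G) by exact: pi_continuous.
have cY : compact [set: decomposition_space G].
  rewrite (_ : setT = quotient_map G @` [set: X]).
    by apply: continuous_compact => //; exact: continuous_subspaceT.
  by apply/seteqP; split=> // y _; have [x <-] := surj y; exists x.
by apply: (strong_shrinking_near_homeomorphism hd hs cX cY cp surj); exact: ss.
Qed.
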